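(* Let $\Lambda$ be a self-injective artin algebra, let $n>1$ be an integer and let $\mathcal{M}$ be an $n\mathbb{Z}$-cluster tilting subcategory of $\mathrm{mod}\text{-}\Lambda$. Let $\underline{\Phi},\underline{\Psi}:\mathcal{S}(\mathcal{M})/\mathcal{W}\to\underline{\mathrm{mod}}\text{-}\underline{\mathcal{M}}$ be the functors induced by $\Phi,\Psi:\mathcal{S}(\mathcal{M})\to\mathrm{mod}\text{-}\underline{\mathcal{M}}$, and let $\Omega_{\underline{\mathcal{M}}}$ be the syzygy functor on $\underline{\mathrm{mod}}\text{-}\underline{\mathcal{M}}$. Then $$\underline{\Phi}=\Omega^n_{\underline{\mathcal{M}}}\circ\underline{\Psi}$$ (up to natural isomorphism). That is, the functors $\underline{\Phi}$ and $\underline{\Psi}$ differ by the $n$-syzygy functor on $\underline{\mathrm{mod}}\text{-}\underline{\mathcal{M}}$.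
   Context: $\mathrm{mod}\text{-}\Lambda$ is the category of finitely generated $\Lambda$-modules; all subcategories are full. A full additive subcategory $\mathcal{M}$ of $\mathrm{mod}\text{-}\Lambda$ is $n$-cluster tilting if it is functorially finite (every module has a right and a left $\mathcal{M}$-approximation), generating-cogenerating (every module is a quotient of an object of $\mathcal{M}$ and embeds in an object of $\mathcal{M}$), and $$\mathcal{M}=\{A: \mathrm{Ext}^i_\Lambda(\mathcal{M},A)=0,\ 0<i<n\}=\{A: \mathrm{Ext}^i_\Lambda(A,\mathcal{M})=0,\ 0<i<n\}.$$ It is $n\mathbb{Z}$-cluster tilting if moreover $\Omega^n_\Lambda(\mathcal{M})\subseteq\mathcal{M}$ (equivalently $\Omega^{-n}_\Lambda(\mathcal{M})\subseteq\mathcal{M}$). $\mathcal{S}(\mathcal{M})$ is the category whose objects are monomorphisms $f:M_1\to M_2$ of $\Lambda$-modules with $M_1,M_2\in\mathcal{M}$, and whose morphisms are commutative squares. $\mathcal{M}(-,M)=\mathrm{Hom}_\Lambda(-,M)|_{\mathcal{M}}$. $\mathrm{mod}\text{-}\mathcal{M}$ is the category of finitely presented additive contravariant functors $\mathcal{M}\to\mathrm{Ab}$; $\mathrm{mod}\text{-}\underline{\mathcal{M}}$ is its full subcategory of functors vanishing on projective $\Lambda$-modules (equivalently, finitely presented functors on $\underline{\mathcal{M}}$, i.e. $\mathcal{M}$ modulo morphisms factoring through projective $\Lambda$-modules). It is abelian with enough projectives; $\underline{\mathrm{mod}}\text{-}\underline{\mathcal{M}}$ is its stable category (modulo morphisms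 factoring through projective objects of $\mathrm{mod}\text{-}\underline{\mathcal{M}}$), and $\Omega_{\underline{\mathcal{M}}}$ sends $F$ to the kernel of a projective cover of $F$ in $\mathrm{mod}\text{-}\underline{\mathcal{M}}$. Definition of $\Phi$: $\Phi=i_\lambda\circ\Upsilon$, where $\Upsilon(M_1\xrightarrow{f}M_2)=\mathrm{Coker}(\mathcal{M}(-,M_1)\xrightarrow{\mathcal{M}(-,f)}\mathcal{M}(-,M_2))$ and $i_\lambda:\mathrm{mod}\text{-}\mathcal{M}\to\mathrm{mod}\text{-}\underline{\mathcal{M}}$ is the left adjoint of the inclusion. Explicitly, for $F\in\mathrm{mod}\text{-}\mathcal{M}$ with minimal projective presentation $\mathcal{M}(-,M^1)\to\mathcal{M}(-,M^0)\to F\to 0$, put $\vartheta(F)=\mathrm{Coker}(M^1\to M^0)$, take a minimal projective presentation $P\to Q\to\vartheta(F)\to 0$, and let $\eta_F:\mathrm{Coker}(\mathcal{M}(-,P)\to\mathcal{M}(-,Q))\to F$ be induced by a lift $P\to M^1$, $Q\to M^0$ of the identity of $\vartheta(F)$; then $i_\lambda(F)=\mathrm{Coker}(\eta_F)$. Definition of $\Psi$: a sequence $0\to X^0\to\cdots\to X^{n+1}\to 0$ in $\mathcal{M}$ is $n$-exact if for every $M\in\mathcal{M}$ both $0\to\mathcal{M}(M,X^0)\to\cdots\to\mathcal{M}(M,X^{n+1})$ and $0\to\mathcal{M}(X^{n+1},M)\to\cdots\to\mathcal{M}(X^0,M)$ are exact. Every monomorphism $f:M_1\to M_2$ in $\mathcal{M}$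 completes, uniquely up to homotopy equivalence, to an $n$-exact sequence $0\to M_1\xrightarrow{f}M_2\to M^1\to\cdots\to M^n\to 0$ in $\mathcal{M}$, and $\Psi(f)=\mathrm{Coker}(\mathcal{M}(-,M^{n-1})\to\mathcal{M}(-,M^n))$; on morphisms $\Psi$ is induced by lifting to morphisms of $n$-exact sequences. $\mathcal{W}$ is the smallest additive subcategory of $\mathcal{S}(\mathcal{M})$ generated by all objects of the form $M\xrightarrow{1}M$, $0\to M$ and $M\to P$ with $M\in\mathcal{M}$ and $P$ a projective $\Lambda$-module; $\mathcal{S}(\mathcal{M})/\mathcal{W}$ is the quotient by the ideal of morphisms factoring through objects of $\mathcal{W}$. Both $\Phi$ and $\Psi$ send objects of $\mathcal{W}$ to projective objects of $\mathrm{mod}\text{-}\underline{\mathcal{M}}$, hence induce $\underline{\Phi}$ and $\underline{\Psi}$. *)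

(* Defs.v *)
From HB Require Import structures.
From mathcomp Require Import all_boot all_algebra.
From mathcomp Require Import boolp.
Set Implicit Arguments.
Unset Strict Implicit.
Unset Printing Implicit Defensive.
Import GRing.Theory.
Local Open Scope ring_scope.

Declare Scope cat_scope.
Delimit Scope cat_scope with cat.

Record precat := Precat {
  obj :> Type;
  hom : obj -> obj -> zmodType;
  idm : forall X, hom X X;
  comp : forall X Y Z, hom Y Z -> hom X Y -> hom X Z;
  comp1m : forall X Y (f : hom X Y), comp (idm Y) f = f;
  compm1 : forall X Y (f : hom X Y), comp f (idm X) = f;
  compA : forall X Y Z T (h : hom Z T) (g : hom Y Z) (f : hom X Y),
    comp h (comp g f) = comp (comp h g) f;
  compDl : forall X Y Z (g g' : hom Y Z) (f : hom X Y),
    comp (g + g') f = comp g f + comp g' f;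
  compDr : forall X Y Z (g : hom Y Z) (f f' : hom X Y),
    comp g (f + f') = comp g f + comp g f' }.

Notation "g \oc f" := (comp g f) (at level 40, left associativity) : cat_scope.
Local Open Scope cat_scope.

Section PrecatTheory.
Variable C : precat.
Implicit Types X Y Z : C.

Lemma comp0m X Y Z (f : hom X Y) : (0 : hom Y Z) \oc f = 0.
Proof. by apply: (addrI (0 \oc f)); rewrite -compDl !addr0. Qed.

Lemma compm0 X Y Z (g : hom Y Z) : g \oc (0 : hom X Y) = 0.
Proof. by apply: (addrI (g \oc 0)); rewrite -compDr !addr0. Qed.

Lemma compNm X Y Z (g : hom Y Z) (f : hom X Y) : (- g) \oc f = - (g \oc f).
Proof. by apply: (addrI (g \oc f)); rewrite -compDl !subrr comp0m. Qed.

Lemma compmN X Y Z (g : hom Y Z) (f : hom X Y) : g \oc (- f) = - (g \oc f).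
Proof. by apply: (addrI (g \oc f)); rewrite -compDr !subrr compm0. Qed.

Lemma compBl X Y Z (g g' : hom Y Z) (f : hom X Y) :
  (g - g') \oc f = g \oc f - g' \oc f.
Proof. by rewrite compDl compNm. Qed.

Lemma compBr X Y Z (g : hom Y Z) (f f' : hom X Y) :
  g \oc (f - f') = g \oc f - g \oc f'.
Proof. by rewrite compDr compmN. Qed.

Definition epi X Y (f : hom X Y) :=
  forall Z (g h : hom Y Z), g \oc f = h \oc f -> g = h.

Definition mono X Y (f : hom X Y) :=
  forall Z (g h : hom Z X), f \oc g = f \oc h -> g = h.

Definition iso X Y (f : hom X Y) :=
  exists g : hom Y X, g \oc f = idm X /\ f \oc g = idm Y.

Definition isomorphic X Y := exists f : hom X Y, iso f.

Definition is_zero X := idm X = 0.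

Definition is_biproduct X Y B :=
  exists (i1 : hom X B) (i2 : hom Y B) (p1 : hom B X) (p2 : hom B Y),
    [/\ p1 \oc i1 = idm X, p2 \oc i2 = idm Y, p1 \oc i2 = 0, p2 \oc i1 = 0
      & i1 \oc p1 + i2 \oc p2 = idm B].

Definition projective X :=
  forall Y Z (e : hom Y Z), epi e ->
    forall f : hom X Z, exists g : hom X Y, f = e \oc g.

Definition injective_object X :=
  forall Y Z (m : hom Y Z), mono m ->
    forall f : hom Y X, exists g : hom Z X, f = g \oc m.

Definition is_kernel X Y K (k : hom K X) (f : hom X Y) :=
  f \oc k = 0 /\
  forall T (t : hom T X), f \oc t = 0 -> exists! u : hom T K, t = k \oc u.

Definition projective_cover P X (e : hom P X) :=
  [/\ projective P, epi e
    & forall Y (g : hom Y P), epi (e \oc g) -> epi g].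

Definition is_syzygy X K :=
  exists P (e : hom P X) (k : hom K P), projective_cover e /\ is_kernel k e.

Fixpoint is_nth_syzygy (n : nat) X K : Prop :=
  if n is m.+1 then exists Y, is_syzygy X Y /\ is_nth_syzygy m Y K
  else K = X.

End PrecatTheory.

Record addcat := Addcat {
  addcat_precat :> precat;
  addcat_zero : exists Z : addcat_precat, is_zero Z;
  addcat_biproduct : forall X Y : addcat_precat, exists B, is_biproduct X Y B }.

(* Closure under all biproduct objects, together with a zero object, includes
   closure under isomorphism. *)
Record additive_class (C : addcat) := AdditiveClass {
  in_class :> C -> Prop;
  class_zero : exists Z, is_zero Z /\ in_class Z;
  class_biproduct : forall X Y B,
    in_class X -> in_class Y -> is_biproduct X Y B -> in_class B }.

Section FullSubcategory.
Variables (C : addcat) (P : additive_class C).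

Definition full_precat : precat :=
  @Precat {X : C | P X} (fun X Y => hom (sval X) (sval Y))
    (fun X => idm (sval X)) (fun X Y Z g f => g \oc f)
    (fun X Y f => comp1m f) (fun X Y f => compm1 f)
    (fun X Y Z T h g f => compA h g f)
    (fun X Y Z g g' f => compDl g g' f) (fun X Y Z g f f' => compDr g f f').

Lemma full_zero : exists Z : full_precat, is_zero Z.
Proof. by have [Z [Z0 PZ]] := class_zero P; exists (exist _ Z PZ). Qed.

Lemma full_biproduct (X Y : full_precat) : exists B, is_biproduct X Y B.
Proof.
have [B bB] := addcat_biproduct (sval X) (sval Y).
have PB : P B := class_biproduct (proj2_sig X) (proj2_sig Y) bB.
by exists (exist _ B PB); case: bB => [i1 [i2 [p1 [p2 h]]]]; exists i1, i2, p1, p2.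
Qed.

Definition full : addcat := Addcat full_zero full_biproduct.

End FullSubcategory.

Section AdditiveClosure.
Variables (C : addcat) (G : C -> Prop).

Inductive in_additive_closure : C -> Prop :=
  | closure_gen X : G X -> in_additive_closure X
  | closure_zero Z : is_zero Z -> in_additive_closure Z
  | closure_biproduct X Y B : in_additive_closure X -> in_additive_closure Y ->
      is_biproduct X Y B -> in_additive_closure B.

Lemma closure_has_zero : exists Z, is_zero Z /\ in_additive_closure Z.
Proof.
by have [Z Z0] := addcat_zero C; exists Z; split=> //; apply: closure_zero.
Qed.

Definition additive_closure : additive_class C :=
  AdditiveClass closure_has_zero closure_biproduct.

End AdditiveClosure.

Section Projectives.
Variable C : addcat.

Lemma projective_zero : exists Z : C, is_zero Z /\ projective Z.
Proof.
have [Z Z0] := addcat_zero C; exists Z; split=> // X Y e _ f.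
by exists 0; rewrite compm0 -[f]compm1 Z0 compm0.
Qed.

Lemma projective_biproduct (X Y B : C) :
  projective X -> projective Y -> is_biproduct X Y B -> projective B.
Proof.
move=> pX pY [i1 [i2 [p1 [p2 [_ _ _ _ e1]]]]] Z T e epi_e f.
have [g1 h1] := pX _ _ e epi_e (f \oc i1).
have [g2 h2] := pY _ _ e epi_e (f \oc i2).
exists (g1 \oc p1 + g2 \oc p2).
by rewrite compDr !compA -h1 -h2 -!compA -compDr e1 compm1.
Qed.

Definition projectives : additive_class C :=
  AdditiveClass projective_zero projective_biproduct.

End Projectives.

Record functor (C D : precat) := Functor {
  fobj :> C -> D;
  fmap : forall X Y : C, hom X Y -> hom (fobj X) (fobj Y);
  fmap1 : forall X, fmap (idm X) = idm (fobj X);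
  fmapM : forall X Y Z (g : hom Y Z) (f : hom X Y),
    fmap (g \oc f) = fmap g \oc fmap f }.

Definition id_functor (C : precat) : functor C C :=
  @Functor C C (fun X => X) (fun X Y f => f) (fun X => erefl)
    (fun X Y Z g f => erefl).

Lemma comp_fmap1 (C D E : precat) (G : functor D E) (F : functor C D) X :
  fmap G (fmap F (idm X)) = idm (G (F X)).
Proof. by rewrite !fmap1. Qed.

Lemma comp_fmapM (C D E : precat) (G : functor D E) (F : functor C D)
  X Y Z (g : hom Y Z) (f : hom X Y) :
  fmap G (fmap F (g \oc f)) = fmap G (fmap F g) \oc fmap G (fmap F f).
Proof. by rewrite !fmapM. Qed.

Definition comp_functor (C D E : precat) (G : functor D E) (F : functor C D) :
  functor C E :=
  @Functor C E (fun X => G (F X)) (fun X Y f => fmap G (fmap F f))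
    (comp_fmap1 G F) (@comp_fmapM C D E G F).

Fixpoint iter_functor (C : precat) (n : nat) (F : functor C C) : functor C C :=
  if n is m.+1 then comp_functor F (iter_functor m F) else id_functor C.

Definition nat_iso (C D : precat) (F G : functor C D) : Prop :=
  exists t : forall X, hom (F X) (G X),
    (forall X, iso (t X)) /\
    (forall X Y (f : hom X Y), t Y \oc fmap F f = fmap G f \oc t X).

Definition left_adjoint (C D : precat) (F : functor C D) (G : functor D C) :=
  exists a : forall X Y, hom (F X) Y -> hom X (G Y),
    (forall X Y, bijective (a X Y)) /\
    (forall X' X Y Y' (u : hom X' X) (h : hom (F X) Y) (v : hom Y Y'),
       a X' Y' (v \oc h \oc fmap F u) = fmap G v \oc a X Y h \oc u).

Definition inclusion (C : addcat) (P : additive_class C) : functor (full P) C :=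
  @Functor (full P) C (fun X => sval X) (fun X Y f => f) (fun X => erefl)
    (fun X Y Z g f => erefl).

Record ideal (C : precat) := Ideal {
  ideal_hom :> forall X Y : C, zmodClosed (hom X Y);
  idealMl : forall X Y Z (g : hom Y Z) (f : hom X Y),
    f \in ideal_hom X Y -> g \oc f \in ideal_hom X Z;
  idealMr : forall X Y Z (g : hom Y Z) (f : hom X Y),
    g \in ideal_hom Y Z -> g \oc f \in ideal_hom X Z }.

Section QuotientCategory.
Variables (C : precat) (I : ideal C).
Local Open Scope quotient_scope.

Definition qhom (X Y : C) : zmodType := Quotient.quot (I X Y).
Definition qpi (X Y : C) (f : hom X Y) : qhom X Y := \pi f.

Lemma qpiP (X Y : C) (f g : hom X Y) :
  qpi f = qpi g <-> f - g \in I X Y.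
Proof.
by rewrite /qpi Quotient.idealrBE; split=> [->|/eqP //]; rewrite eqxx.
Qed.

Lemma qpi_repr (X Y : C) (u : qhom X Y) : qpi (repr u) = u.
Proof. exact: reprK. Qed.

Definition qcomp (X Y Z : C) (g : qhom Y Z) (f : qhom X Y) : qhom X Z :=
  qpi (repr g \oc repr f).

Lemma qcomp_pi (X Y Z : C) (g : hom Y Z) (f : hom X Y) :
  qcomp (qpi g) (qpi f) = qpi (g \oc f).
Proof.
apply/qpiP; set g' := repr _; set f' := repr _.
have hg : g' - g \in I Y Z by apply/qpiP; rewrite qpi_repr.
have hf : f' - f \in I X Y by apply/qpiP; rewrite qpi_repr.
have -> : g' \oc f' - g \oc f = (g' - g) \oc f' + g \oc (f' - f).
  by rewrite compBl compBr addrA subrK.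
by apply: rpredD; [apply: idealMr | apply: idealMl].
Qed.

Lemma qpiD (X Y : C) (f g : hom X Y) : qpi (f + g) = qpi f + qpi g.
Proof. by rewrite /qpi piE. Qed.

Lemma qcomp1m (X Y : C) (f : qhom X Y) : qcomp (qpi (idm Y)) f = f.
Proof. by rewrite -[f]qpi_repr qcomp_pi comp1m. Qed.

Lemma qcompm1 (X Y : C) (f : qhom X Y) : qcomp f (qpi (idm X)) = f.
Proof. by rewrite -[f]qpi_repr qcomp_pi compm1. Qed.

Lemma qcompA (X Y Z T : C) (h : qhom Z T) (g : qhom Y Z) (f : qhom X Y) :
  qcomp h (qcomp g f) = qcomp (qcomp h g) f.
Proof.
by rewrite -[f]qpi_repr -[g]qpi_repr -[h]qpi_repr !qcomp_pi compA.
Qed.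

Lemma qcompDl (X Y Z : C) (g g' : qhom Y Z) (f : qhom X Y) :
  qcomp (g + g') f = qcomp g f + qcomp g' f.
Proof.
rewrite -[f]qpi_repr -[g]qpi_repr -[g']qpi_repr -qpiD !qcomp_pi.
by rewrite compDl qpiD.
Qed.

Lemma qcompDr (X Y Z : C) (g : qhom Y Z) (f f' : qhom X Y) :
  qcomp g (f + f') = qcomp g f + qcomp g f'.
Proof.
rewrite -[g]qpi_repr -[f]qpi_repr -[f']qpi_repr -qpiD !qcomp_pi.
by rewrite compDr qpiD.
Qed.

Definition quot_cat : precat :=
  Precat qcomp1m qcompm1 qcompA qcompDl qcompDr.

End QuotientCategory.

Arguments qpi {C} I {X Y} f.

Section InducedFunctor.
Variables (C D : precat) (I : ideal C) (J : ideal D) (F : functor C D).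

Definition respects_ideals :=
  forall (X Y : C) (f g : hom X Y),
    f - g \in I X Y -> fmap F f - fmap F g \in J (F X) (F Y).

Hypothesis rF : respects_ideals.

Let imap (X Y : C) (u : qhom I X Y) : qhom J (F X) (F Y) :=
  qpi J (fmap F (repr u)).

Lemma imap_pi (X Y : C) (f : hom X Y) : imap (qpi I f) = qpi J (fmap F f).
Proof. by apply/qpiP/rF/qpiP; rewrite qpi_repr. Qed.

Lemma imap1 (X : quot_cat I) : imap (idm X) = idm (F X : quot_cat J).
Proof. by rewrite [LHS]imap_pi fmap1. Qed.

Lemma imapM (X Y Z : quot_cat I) (g : hom Y Z) (f : hom X Y) :
  imap (g \oc f) = (imap g : hom (F Y : quot_cat J) (F Z)) \oc imap f.
Proof.
rewrite -[f]qpi_repr -[g]qpi_repr /= qcomp_pi !imap_pi.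
by rewrite [RHS]qcomp_pi fmapM.
Qed.

Definition induced : functor (quot_cat I) (quot_cat J) :=
  @Functor (quot_cat I) (quot_cat J) (fun X => F X) imap imap1 imapM.

End InducedFunctor.

Section FactorIdeal.
Variables (C : addcat) (W : additive_class C).

Definition factors_through (X Y : C) (f : hom X Y) : Prop :=
  exists Z, W Z /\ exists (g : hom X Z) (h : hom Z Y), f = h \oc g.

Definition factor_pred (X Y : C) : {pred hom X Y} :=
  fun f => `[< factors_through f >].
Arguments factor_pred : clear implicits.

Lemma factor_zmod_closed (X Y : C) : zmod_closed (factor_pred X Y).
Proof.
split.
  apply/asboolP; have [Z [_ WZ]] := class_zero W.
  by exists Z; split=> //; exists 0, 0; rewrite comp0m.
move=> f f' /asboolP[Z [WZ [g [h ->]]]] /asboolP[Z' [WZ' [g' [h' ->]]]].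
apply/asboolP; have [B bB] := addcat_biproduct Z Z'.
exists B; split; first exact: class_biproduct bB.
case: bB => i1 [i2 [p1 [p2 [e1 e2 e3 e4 _]]]].
exists (i1 \oc g + i2 \oc g'), (h \oc p1 - h' \oc p2).
rewrite compBl !compDr -!compA (compA p1) (compA p1) (compA p2) (compA p2).
by rewrite e1 e2 e3 e4 !comp1m !comp0m !compm0 addr0 add0r.
Qed.

HB.instance Definition _ (X Y : C) :=
  GRing.isZmodClosed.Build (hom X Y) (factor_pred X Y)
    (@factor_zmod_closed X Y).

Lemma factor_idealMl (X Y Z : C) (g : hom Y Z) (f : hom X Y) :
  f \in (factor_pred X Y : zmodClosed _) -> g \oc f \in factor_pred X Z.
Proof.
case/asboolP=> T [WT [a [b ->]]]; apply/asboolP; exists T; split=> //.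
by exists a, (g \oc b); rewrite compA.
Qed.

Lemma factor_idealMr (X Y Z : C) (g : hom Y Z) (f : hom X Y) :
  g \in (factor_pred Y Z : zmodClosed _) -> g \oc f \in factor_pred X Z.
Proof.
case/asboolP=> T [WT [a [b ->]]]; apply/asboolP; exists T; split=> //.
by exists (a \oc f), b; rewrite compA.
Qed.

Definition factor_ideal : ideal C :=
  @Ideal C (fun X Y => factor_pred X Y) factor_idealMl factor_idealMr.

End FactorIdeal.

Definition stable (C : addcat) : precat :=
  quot_cat (factor_ideal (projectives C)).

(* Syzygies are determined only up to a choice of projective covers; a syzygy
   functor is any functor obtained from such a choice. *)
Definition is_syzygy_functor (C : addcat) (Om : functor (stable C) (stable C)) :=
  exists (P : C -> C) (e : forall X, hom (P X) X)
         (k : forall X, hom (Om X : C) (P X)),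
    (forall X, projective_cover (e X) /\ is_kernel (k X) (e X)) /\
    (forall (X Y : C) (f : hom X Y),
       exists (p : hom (P X) (P Y)) (w : hom (Om X : C) (Om Y : C)),
         [/\ e Y \oc p = f \oc e X, k Y \oc w = p \oc k X
           & fmap Om (qpi _ f : hom (X : stable C) Y) = qpi _ w]).

Record arrow (C : precat) := Arrow {
  src : C;
  tgt : C;
  arr : hom src tgt }.

Section ArrowCategory.
Variable C : addcat.
Implicit Types F G H : arrow C.

Definition square_pred F G : {pred hom (src F) (src G) * hom (tgt F) (tgt G)} :=
  fun u => arr G \oc u.1 == u.2 \oc arr F.
Arguments square_pred : clear implicits.

Lemma square_zmod_closed F G : zmod_closed (square_pred F G).
Proof.
split=> [|u v]; first by apply/eqP; rewrite /= compm0 comp0m.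
by move=> /eqP hu /eqP hv; apply/eqP; rewrite /= compBr compBl hu hv.
Qed.

HB.instance Definition _ F G :=
  GRing.isZmodClosed.Build _ (square_pred F G) (@square_zmod_closed F G).

Record square F G := Square {
  square_val :> hom (src F) (src G) * hom (tgt F) (tgt G);
  squareP : square_val \in square_pred F G }.

HB.instance Definition _ F G := [isSub for @square_val F G].
HB.instance Definition _ F G := [Choice of square F G by <:].
HB.instance Definition _ F G := [SubChoice_isSubZmodule of square F G by <:].

Lemma square_comm F G (u : square F G) : arr G \oc u.1 = u.2 \oc arr F.
Proof. exact/eqP/(squareP u). Qed.

Lemma square_id_proof F : (idm (src F), idm (tgt F)) \in square_pred F F.
Proof. by apply/eqP; rewrite /= comp1m compm1. Qed.

Lemma square_comp_proof F G H (v : square G H) (u : square F G) :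
  (v.1 \oc u.1, v.2 \oc u.2) \in square_pred F H.
Proof.
by apply/eqP; rewrite /= compA square_comm -compA square_comm compA.
Qed.

Definition square_id F : square F F := Square (square_id_proof F).
Definition square_comp F G H (v : square G H) (u : square F G) : square F H :=
  Square (square_comp_proof v u).

Lemma square_eq F G (u v : square F G) : u.1 = v.1 -> u.2 = v.2 -> u = v.
Proof.
by move=> e1 e2; apply: val_inj; case: u v e1 e2 => [[? ?] ?] [[? ?] ?] /= -> ->.
Qed.

Definition arrow_precat : precat.
Proof.
apply: (@Precat (arrow C) (fun F G => square F G) square_id square_comp).
- by move=> F G u; apply: square_eq; rewrite /= comp1m.
- by move=> F G u; apply: square_eq; rewrite /= compm1.
- by move=> F G H K w v u; apply: square_eq; rewrite /= compA.
- by move=> F G H v v' u; apply: square_eq; rewrite /= compDl.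
- by move=> F G H v u u'; apply: square_eq; rewrite /= compDr.
Defined.

Lemma arrow_zero : exists Z : arrow_precat, is_zero Z.
Proof.
have [Z Z0] := addcat_zero C.
by exists (Arrow (idm Z)); apply: square_eq; rewrite /= Z0.
Qed.

Lemma arrow_biproduct (F G : arrow_precat) : exists B, is_biproduct F G B.
Proof.
case: F G => [X X' f] [Y Y' g].
have [B [i [j [p [q [e1 e2 e3 e4 e5]]]]]] := addcat_biproduct X Y.
have [B' [i' [j' [p' [q' [e1' e2' e3' e4' e5']]]]]] := addcat_biproduct X' Y'.
pose b := i' \oc f \oc p + j' \oc g \oc q.
have hi : (i, i') \in square_pred (Arrow f) (Arrow b).
  apply/eqP; rewrite /= compDl -!compA e1 e4 compm1 !compm0.
  by rewrite addr0.
have hj : (j, j') \in square_pred (Arrow g) (Arrow b).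
  apply/eqP; rewrite /= compDl -!compA e2 e3 compm1 !compm0.
  by rewrite add0r.
have hp : (p, p') \in square_pred (Arrow b) (Arrow f).
  apply/eqP; rewrite /= compDr !compA e1' e3' comp1m !comp0m.
  by rewrite addr0.
have hq : (q, q') \in square_pred (Arrow b) (Arrow g).
  apply/eqP; rewrite /= compDr !compA e2' e4' comp1m !comp0m.
  by rewrite add0r.
exists (Arrow b), (Square hi), (Square hj), (Square hp), (Square hq).
by split; apply: square_eq.
Qed.

Definition arrows : addcat := Addcat arrow_zero arrow_biproduct.

Lemma arrow_is_zero_src (Z : arrows) : is_zero Z -> idm (src Z) = 0.
Proof. by move=> Z0; have := congr1 (fun u : square Z Z => u.1) Z0. Qed.

Lemma arrow_biproduct_src (F G B : arrows) : is_biproduct F G B ->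
  exists (i1 : square F B) (i2 : square G B) (p1 : square B F) (p2 : square B G),
    i1.1 \oc p1.1 + i2.1 \oc p2.1 = idm (src B).
Proof.
move=> [i1 [i2 [p1 [p2 [_ _ _ _ e]]]]]; exists i1, i2, p1, p2.
by have := congr1 (fun u : square B B => u.1) e.
Qed.

End ArrowCategory.

(* Finite sequences X^0 -> ... -> X^(n+1) are encoded as infinite sequences of
   morphisms of which only the part in degrees 0, ..., n+1 is ever used; no
   condition is imposed outside this range. *)
Record sequence_in (C : precat) := SequenceIn {
  sq_ob :> nat -> C;
  sq_d : forall i, hom (sq_ob i) (sq_ob i.+1) }.

Section NExact.
Variables (C : precat) (n : nat).

Definition n_exact (X : sequence_in C) : Prop :=
  forall M : C,
    [/\ forall u : hom M (X 0), sq_d X 0 \oc u = 0 -> u = 0,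
        forall i, (i < n)%N -> forall u : hom M (X i.+1),
          sq_d X i.+1 \oc u = 0 <-> exists v, u = sq_d X i \oc v,
        forall u : hom (X n.+1) M, u \oc sq_d X n = 0 -> u = 0
      & forall i, (i < n)%N -> forall u : hom (X i.+1) M,
          u \oc sq_d X i = 0 <-> exists v, u = v \oc sq_d X i.+1].

Definition is_sq_map (X Y : sequence_in C) (phi : forall i, hom (X i) (Y i)) :=
  forall i, (i <= n)%N -> sq_d Y i \oc phi i = phi i.+1 \oc sq_d X i.

(* The sequence X0 -f-> X1 -g-> T 0 -> T 1 -> ... *)
Definition splice_ob (X0 X1 : C) (T : sequence_in C) (i : nat) : C :=
  match i with 0 => X0 | 1 => X1 | j.+2 => T j end.

Definition splice (X0 X1 : C) (f : hom X0 X1) (T : sequence_in C)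
    (g : hom X1 (T 0)) : sequence_in C :=
  @SequenceIn C (splice_ob X0 X1 T) (fun i =>
    match i return hom (splice_ob X0 X1 T i) (splice_ob X0 X1 T i.+1) with
    | 0 => f | 1 => g | j.+2 => sq_d T j end).

End NExact.

(* A full additive subcategory is presented by a family of objects, and X
   belongs to it when X is isomorphic to a member of the family.  The index
   type lives in the universe of the carriers of the groups and modules, so
   that natural transformations between functors on the subcategory form a
   [zmodType].  Skeletally small subcategories are all of this form: a finitely
   generated A-module is some A^m / N, and the pairs (m, N) form such a type. *)
Record additive_family (C : addcat) := AdditiveFamily {
  idx : Type;
  member :> idx -> C;
  family_zero : exists i, is_zero (member i);
  family_biproduct : forall i j, exists k,
    is_biproduct (member i) (member j) (member k) }.
Arguments family_biproduct {C} _ i j.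

Section FamilyCategory.
Variables (C : addcat) (M : additive_family C).

Definition in_family (X : C) : Prop := exists i, isomorphic X (M i).

Definition family_precat : precat :=
  @Precat (idx M) (fun i j => hom (M i) (M j))
    (fun i => idm (M i)) (fun i j k g f => g \oc f)
    (fun i j f => comp1m f) (fun i j f => compm1 f)
    (fun i j k l h g f => compA h g f)
    (fun i j k g g' f => compDl g g' f) (fun i j k g f f' => compDr g f f').

Definition family_cat : addcat :=
  @Addcat family_precat (family_zero M) (family_biproduct M).

(* Explicit conversions such as [fhom] and [app] keep the type checker from
   unfolding nested full subcategories. *)
Definition fhom (i j : idx M) (f : @hom family_cat i j) : hom (M i) (M j) := f.

Lemma fhom_comp (i j k : idx M) (g : @hom family_cat j k) (f : @hom family_cat i j) :
  fhom (g \oc f) = fhom g \oc fhom f.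
Proof. by []. Qed.

Lemma fhom_add (i j : idx M) (f g : @hom family_cat i j) :
  fhom (f + g) = fhom f + fhom g.
Proof. by []. Qed.

Lemma fhom_id (i : idx M) : fhom (@idm family_cat i) = idm (M i).
Proof. by []. Qed.

Lemma fhom_zero (i j : idx M) : fhom (0 : @hom family_cat i j) = 0.
Proof. by []. Qed.

End FamilyCategory.

Record presheaf (C : addcat) (M : additive_family C) := Presheaf {
  psh_ob :> idx M -> zmodType;
  psh_map : forall X Y, hom (M X) (M Y) -> {additive psh_ob Y -> psh_ob X};
  psh_map1 : forall X x, psh_map (idm (M X)) x = x;
  psh_mapM : forall X Y Z (g : hom (M Y) (M Z)) (f : hom (M X) (M Y)) x,
    psh_map (g \oc f) x = psh_map f (psh_map g x);
  psh_mapD : forall X Y (f g : hom (M X) (M Y)) x,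
    psh_map (f + g) x = psh_map f x + psh_map g x }.

Record nat_trans (C : addcat) (M : additive_family C) (F G : presheaf M) :=
  NatTrans {
    nt_ap :> forall X, {additive F X -> G X};
    nt_natural : forall X Y (f : hom (M X) (M Y)) x,
      nt_ap X (psh_map F f x) = psh_map G f (nt_ap Y x) }.

Lemma additive_eq (U V : zmodType) (f g : {additive U -> V}) : f =1 g -> f = g.
Proof.
case: f => f [[a]]; case: g => g [[b]] /= e0.
have e : f = g by apply: funext.
by subst g; rewrite (Prop_irrelevance a b).
Qed.

Lemma nat_trans_eq (C : addcat) (M : additive_family C) (F G : presheaf M)
  (s t : nat_trans F G) :
  (forall X x, s X x = t X x) -> s = t.
Proof.
case: s => s hs; case: t => t ht /= e0.
have e : s = t.
  by apply: functional_extensionality_dep => X; apply: additive_eq; apply: e0.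
by subst t; rewrite (Prop_irrelevance hs ht).
Qed.

Section PresheafCategory.
Variables (C : addcat) (M : additive_family C).
Implicit Types F G H : presheaf M.

HB.instance Definition _ F G := gen_eqMixin (nat_trans F G).
HB.instance Definition _ F G := gen_choiceMixin (nat_trans F G).

Definition nt_zero F G : nat_trans F G.
Proof.
by exists (fun X => \0 : {additive F X -> G X}) => X Y f x /=; rewrite raddf0.
Defined.

Definition nt_opp F G (s : nat_trans F G) : nat_trans F G.
Proof.
exists (fun X => GRing.opp_fun (s X) : {additive F X -> G X}) => X Y f x /=.
by rewrite nt_natural raddfN.
Defined.

Definition nt_add F G (s t : nat_trans F G) : nat_trans F G.
Proof.
exists (fun X => GRing.add_fun (s X) (t X) : {additive F X -> G X}) => X Y f x /=.
by rewrite !nt_natural raddfD.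
Defined.

Lemma nt_addA F G : associative (@nt_add F G).
Proof. by move=> r s t; apply: nat_trans_eq => X x /=; rewrite addrA. Qed.
Lemma nt_addC F G : commutative (@nt_add F G).
Proof. by move=> s t; apply: nat_trans_eq => X x /=; rewrite addrC. Qed.
Lemma nt_add0 F G : left_id (@nt_zero F G) (@nt_add F G).
Proof. by move=> s; apply: nat_trans_eq => X x /=; rewrite add0r. Qed.
Lemma nt_addN F G : left_inverse (@nt_zero F G) (@nt_opp F G) (@nt_add F G).
Proof. by move=> s; apply: nat_trans_eq => X x /=; rewrite addNr. Qed.

HB.instance Definition _ F G := GRing.isZmodule.Build (nat_trans F G)
  (@nt_addA F G) (@nt_addC F G) (@nt_add0 F G) (@nt_addN F G).

Definition nt_id F : nat_trans F F.
Proof. by exists (fun X => idfun : {additive F X -> F X}). Defined.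

Definition nt_comp F G H (t : nat_trans G H) (s : nat_trans F G) :
  nat_trans F H.
Proof.
exists (fun X => t X \o s X : {additive F X -> H X}) => X Y f x /=.
by rewrite !nt_natural.
Defined.

Definition psh_precat : precat.
Proof.
refine (@Precat (presheaf M) (fun F G => nat_trans F G) nt_id nt_comp _ _ _ _ _).
- by move=> F G u; apply: nat_trans_eq.
- by move=> F G u; apply: nat_trans_eq.
- by move=> F G H K w v u; apply: nat_trans_eq.
- by move=> F G H v v' u; apply: nat_trans_eq.
- by move=> F G H v u u'; apply: nat_trans_eq => X x /=; rewrite raddfD.
Defined.

Definition psh_zero : presheaf M.
Proof.
by exists (fun _ => 'I_1 : zmodType) (fun _ _ _ => \0 : {additive 'I_1 -> 'I_1});
  move=> *; rewrite /= ?addr0 //; apply/esym/ord1.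
Defined.

Lemma psh_has_zero : exists Z : psh_precat, is_zero Z.
Proof. by exists psh_zero; apply: nat_trans_eq => X x; rewrite /= [LHS]ord1. Qed.

Section Sum.
Variables F G : presheaf M.

Definition psh_sum_map (X Y : idx M) (f : hom (M X) (M Y)) (x : F Y * G Y) : F X * G X :=
  (psh_map F f x.1, psh_map G f x.2).

Lemma psh_sum_map_additive X Y f : zmod_morphism (@psh_sum_map X Y f).
Proof. by move=> x y; rewrite /psh_sum_map /= !raddfB. Qed.

HB.instance Definition _ X Y f :=
  GRing.isZmodMorphism.Build _ _ (@psh_sum_map X Y f)
    (@psh_sum_map_additive X Y f).

Definition psh_sum : presheaf M.
Proof.
exists (fun X => (F X * G X)%type : zmodType)
  (fun X Y f => @psh_sum_map X Y f : {additive _ -> _}) => /=.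
- by move=> X [x y]; rewrite /psh_sum_map /= !psh_map1.
- by move=> X Y Z g f [x y]; rewrite /psh_sum_map /= !psh_mapM.
- by move=> X Y f g [x y]; rewrite /psh_sum_map /= !psh_mapD.
Defined.

End Sum.

Definition in1 (U V : zmodType) (x : U) : U * V := (x, 0).
Definition in2 (U V : zmodType) (y : V) : U * V := (0, y).
Lemma in1_additive U V : zmod_morphism (@in1 U V).
Proof. by move=> x y; congr pair; rewrite /= subr0. Qed.
Lemma in2_additive U V : zmod_morphism (@in2 U V).
Proof. by move=> x y; congr pair; rewrite /= subr0. Qed.
HB.instance Definition _ U V :=
  GRing.isZmodMorphism.Build _ _ (@in1 U V) (@in1_additive U V).
HB.instance Definition _ U V :=
  GRing.isZmodMorphism.Build _ _ (@in2 U V) (@in2_additive U V).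

Lemma psh_has_biproduct (F G : psh_precat) : exists B, is_biproduct F G B.
Proof.
have h1 X Y (f : hom (M X) (M Y)) (x : F Y) :
    in1 (G X) (psh_map F f x) = psh_map (psh_sum F G) f (in1 (G Y) x).
  by rewrite /in1 /= /psh_sum_map /= raddf0.
have h2 X Y (f : hom (M X) (M Y)) (x : G Y) :
    in2 (F X) (psh_map G f x) = psh_map (psh_sum F G) f (in2 (F Y) x).
  by rewrite /in2 /= /psh_sum_map /= raddf0.
pose i1 : nat_trans F (psh_sum F G) :=
  @NatTrans _ _ F (psh_sum F G) (fun X => @in1 (F X) (G X) : {additive _ -> _}) h1.
pose i2 : nat_trans G (psh_sum F G) :=
  @NatTrans _ _ G (psh_sum F G) (fun X => @in2 (F X) (G X) : {additive _ -> _}) h2.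
pose p1 : nat_trans (psh_sum F G) F :=
  @NatTrans _ _ (psh_sum F G) F (fun X => fst : {additive (F X * G X)%type -> _})
    (fun X Y f x => erefl).
pose p2 : nat_trans (psh_sum F G) G :=
  @NatTrans _ _ (psh_sum F G) G (fun X => snd : {additive (F X * G X)%type -> _})
    (fun X Y f x => erefl).
exists (psh_sum F G), i1, i2, p1, p2; split; apply: nat_trans_eq => X x //=.
by case: x => x y; congr pair; rewrite /= ?addr0 ?add0r.
Qed.

Definition psh : addcat := Addcat psh_has_zero psh_has_biproduct.

Section Yoneda.
Variable X : idx M.

Definition precomp (Y Z : idx M) (f : hom (M Y) (M Z)) (u : hom (M Z) (M X)) :
  hom (M Y) (M X) := u \oc f.
Lemma precomp_additive Y Z f : zmod_morphism (@precomp Y Z f).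
Proof. by move=> u v; rewrite /precomp compBl. Qed.
HB.instance Definition _ Y Z f :=
  GRing.isZmodMorphism.Build _ _ (@precomp Y Z f) (@precomp_additive Y Z f).

Definition yoneda : presheaf M.
Proof.
exists (fun Y => hom (M Y) (M X)) (fun Y Z f => @precomp Y Z f : {additive _ -> _});
  rewrite /= /precomp.
- by move=> Y u; rewrite compm1.
- by move=> Y Z T g f u; rewrite compA.
- by move=> Y Z f g u; rewrite compDr.
Defined.

End Yoneda.

(* [p] exhibits F as the cokernel of M(-, f) : M(-, X1) -> M(-, X0). *)
Definition presents (X1 X0 : idx M) (f : hom (M X1) (M X0)) F
    (p : nat_trans (yoneda X0) F) : Prop :=
  forall Z,
    (forall y : F Z, exists u : hom (M Z) (M X0), p Z u = y) /\
    (forall u : hom (M Z) (M X0),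
       p Z u = 0 <-> exists v : hom (M Z) (M X1), u = f \oc v).

Definition finitely_presented F : Prop :=
  exists (X1 X0 : idx M) (f : hom (M X1) (M X0)) (p : nat_trans (yoneda X0) F),
    presents f p.

Definition postcomp (X Y Z : idx M) (f : hom (M X) (M Y)) (u : hom (M Z) (M X)) :
  hom (M Z) (M Y) := f \oc u.
Lemma postcomp_additive X Y Z f : zmod_morphism (@postcomp X Y Z f).
Proof. by move=> u v; rewrite /postcomp compBr. Qed.
HB.instance Definition _ X Y Z f :=
  GRing.isZmodMorphism.Build _ _ (@postcomp X Y Z f) (@postcomp_additive X Y Z f).

Definition yoneda_map (X Y : idx M) (f : hom (M X) (M Y)) :
  nat_trans (yoneda X) (yoneda Y).
Proof.
exists (fun Z => @postcomp X Y Z f : {additive hom (M Z) (M X) -> hom (M Z) (M Y)}).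
by move=> Z T g u; rewrite /= /precomp /postcomp compA.
Defined.

Lemma fp_zero : exists Z : psh, is_zero Z /\ finitely_presented Z.
Proof.
exists psh_zero; split; first by apply: nat_trans_eq => X x; rewrite /= [LHS]ord1.
have [z z0] := family_zero M.
have hz X (u : hom (M X) (M z)) : u = 0 by rewrite -[u]comp1m z0 comp0m.
exists z, z, 0, (0 : nat_trans _ _) => Z; split=> [y|u].
  by exists 0; apply/esym/ord1.
by split=> // _; exists 0; rewrite comp0m [LHS]hz.
Qed.

Lemma fp_biproduct (F G B : psh) : finitely_presented F ->
  finitely_presented G -> is_biproduct F G B -> finitely_presented B.
Proof.
move=> [X1 [X0 [f [p pP]]]] [Y1 [Y0 [g [q qP]]]].
case=> [i1 [i2 [p1 [p2 [e1 e2 e3 e4 e5]]]]].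
have [Z0 [a1 [a2 [b1 [b2 [h1 h2 h3 h4 h5]]]]]] := family_biproduct M X0 Y0.
have [Z1 [c1 [c2 [d1 [d2 [k1 k2 k3 k4 k5]]]]]] := family_biproduct M X1 Y1.
pose r : nat_trans (yoneda Z0) B :=
  nt_add (nt_comp i1 (nt_comp p (yoneda_map b1)))
         (nt_comp i2 (nt_comp q (yoneda_map b2))).
have rE Z (u : hom (M Z) (M Z0)) :
  r Z u = (i1 : nat_trans F B) Z (p Z (b1 \oc u))
        + (i2 : nat_trans G B) Z (q Z (b2 \oc u)) by [].
have E1 Z x : (p1 : nat_trans B F) Z ((i1 : nat_trans F B) Z x) = x.
  by have := congr1 (fun s : nat_trans F F => s Z x) e1.
have E2 Z x : (p2 : nat_trans B G) Z ((i2 : nat_trans G B) Z x) = x.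
  by have := congr1 (fun s : nat_trans G G => s Z x) e2.
have E3 Z x : (p1 : nat_trans B F) Z ((i2 : nat_trans G B) Z x) = 0.
  by have := congr1 (fun s : nat_trans G F => s Z x) e3.
have E4 Z x : (p2 : nat_trans B G) Z ((i1 : nat_trans F B) Z x) = 0.
  by have := congr1 (fun s : nat_trans F G => s Z x) e4.
have E5 Z x : (i1 : nat_trans F B) Z ((p1 : nat_trans B F) Z x)
            + (i2 : nat_trans G B) Z ((p2 : nat_trans B G) Z x) = x.
  by have := congr1 (fun s : nat_trans B B => s Z x) e5.
exists Z1, Z0, (a1 \oc f \oc d1 + a2 \oc g \oc d2), r => Z; split=> [y|u].
  have [u hu] := (pP Z).1 ((p1 : nat_trans B F) Z y).
  have [v hv] := (qP Z).1 ((p2 : nat_trans B G) Z y).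
  exists (a1 \oc u + a2 \oc v); rewrite rE !compDr !compA h1 h2 h3 h4.
  by rewrite !comp1m !comp0m addr0 add0r hu hv E5.
split=> [|[v ->]].
  rewrite rE => ru0.
  have := congr1 ((p1 : nat_trans B F) Z) ru0.
  rewrite raddfD E1 E3 addr0 raddf0 => /(pP Z).2[v1 hv1].
  have := congr1 ((p2 : nat_trans B G) Z) ru0.
  rewrite raddfD E2 E4 add0r raddf0 => /(qP Z).2[v2 hv2].
  exists (c1 \oc v1 + c2 \oc v2); rewrite compDl !compDr.
  rewrite -!compA (compA d1) (compA d1) (compA d2) (compA d2) k1 k2 k3 k4.
  rewrite !comp1m !comp0m !compm0 addr0 add0r -hv1 -hv2 !compA -compDl h5.
  by rewrite comp1m.
rewrite rE compDl !compDr !compA h1 h2 h3 h4 !comp1m !comp0m addr0 add0r.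
rewrite -!compA.
have -> : p Z (f \oc (d1 \oc v)) = 0 by apply/(pP Z).2; exists (d1 \oc v).
have -> : q Z (g \oc (d2 \oc v)) = 0 by apply/(qP Z).2; exists (d2 \oc v).
by rewrite !raddf0 addr0.
Qed.

Definition fp_class : additive_class psh := AdditiveClass fp_zero fp_biproduct.

Definition mod_cat : addcat := full fp_class.

Definition vanishes_on_projectives (F : mod_cat) : Prop :=
  forall X : idx M, projective (M X) -> forall x : sval F X, x = 0.

Lemma vanishing_zero :
  exists Z : mod_cat, is_zero Z /\ vanishes_on_projectives Z.
Proof.
have [Z Z0] := addcat_zero mod_cat; exists Z; split=> // X _ x.
by have := congr1 (fun s : nat_trans (sval Z) (sval Z) => s X x) Z0.
Qed.

Lemma vanishing_biproduct (F G B : mod_cat) :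
  vanishes_on_projectives F -> vanishes_on_projectives G ->
  is_biproduct F G B -> vanishes_on_projectives B.
Proof.
move=> vF vG [i1 [i2 [p1 [p2 [_ _ _ _ e]]]]] X pX x.
have := congr1 (fun s : nat_trans (sval B) (sval B) => s X x) e.
rewrite /= (vF X pX ((p1 : nat_trans (sval B) (sval F)) X x)).
rewrite (vG X pX ((p2 : nat_trans (sval B) (sval G)) X x)).
by rewrite !raddf0 addr0.
Qed.

Definition vanishing_class : additive_class mod_cat :=
  AdditiveClass vanishing_zero vanishing_biproduct.

(* [mod_cat] is mod-M and [umod_cat] is mod-\underline{M}. *)
Definition umod_cat : addcat := full vanishing_class.

End PresheafCategory.

Section ModuleCategory.
Variable A : pzRingType.

Definition lin (X Y : lmodType A) : Type := {linear X -> Y}.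

Section LinZmod.
Variables X Y : lmodType A.

Lemma lin_eq (f g : {linear X -> Y}) : f =1 g -> f = g.
Proof.
case: f => f [[a1] [a2]]; case: g => g [[b1] [b2]] /= e0.
have e : f = g by apply: funext.
by subst g; rewrite (Prop_irrelevance a1 b1) (Prop_irrelevance a2 b2).
Qed.

HB.instance Definition _ := gen_eqMixin (lin X Y).
HB.instance Definition _ := gen_choiceMixin (lin X Y).

Definition lin_zero : lin X Y := (\0 : {linear X -> Y}).
Definition lin_opp (f : lin X Y) : lin X Y :=
  (GRing.opp_fun (f : {linear X -> Y}) : {linear X -> Y}).
Definition lin_add (f g : lin X Y) : lin X Y :=
  (GRing.add_fun (f : {linear X -> Y}) (g : {linear X -> Y}) : {linear X -> Y}).

Lemma lin_addA : associative lin_add.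
Proof. by move=> f g h; apply: lin_eq => x /=; rewrite addrA. Qed.
Lemma lin_addC : commutative lin_add.
Proof. by move=> f g; apply: lin_eq => x /=; rewrite addrC. Qed.
Lemma lin_add0 : left_id lin_zero lin_add.
Proof. by move=> f; apply: lin_eq => x /=; rewrite add0r. Qed.
Lemma lin_addN : left_inverse lin_zero lin_opp lin_add.
Proof. by move=> f; apply: lin_eq => x /=; rewrite addNr. Qed.

HB.instance Definition _ := GRing.isZmodule.Build (lin X Y)
  lin_addA lin_addC lin_add0 lin_addN.

End LinZmod.

Definition lin_id (X : lmodType A) : lin X X := (idfun : {linear X -> X}).
Definition lin_comp (X Y Z : lmodType A) (g : lin Y Z) (f : lin X Y) : lin X Z :=
  ((g : {linear Y -> Z}) \o (f : {linear X -> Y}) : {linear X -> Z}).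

Definition Mod_precat : precat.
Proof.
refine (@Precat (lmodType A) (fun X Y => lin X Y) lin_id lin_comp _ _ _ _ _).
- by move=> X Y f; apply: lin_eq.
- by move=> X Y f; apply: lin_eq.
- by move=> X Y Z T h g f; apply: lin_eq.
- by move=> X Y Z g g' f; apply: lin_eq.
- by move=> X Y Z g f f'; apply: lin_eq => x /=; rewrite linearD.
Defined.

Lemma Mod_zero : exists Z : Mod_precat, is_zero Z.
Proof. by exists ('rV[A]_0 : lmodType A); apply: lin_eq => x; rewrite /= [LHS]thinmx0. Qed.

Definition lin_inl (X Y : lmodType A) (x : X) : X * Y := (x, 0).
Definition lin_inr (X Y : lmodType A) (y : Y) : X * Y := (0, y).
Lemma lin_inl_linear X Y : linear (@lin_inl X Y).
Proof. by move=> a x y; congr pair; rewrite /= scaler0 addr0. Qed.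
Lemma lin_inr_linear X Y : linear (@lin_inr X Y).
Proof. by move=> a x y; congr pair; rewrite /= scaler0 addr0. Qed.
HB.instance Definition _ X Y :=
  GRing.isLinear.Build _ _ _ _ (@lin_inl X Y) (@lin_inl_linear X Y).
HB.instance Definition _ X Y :=
  GRing.isLinear.Build _ _ _ _ (@lin_inr X Y) (@lin_inr_linear X Y).

Lemma Mod_biproduct (X Y : Mod_precat) : exists B, is_biproduct X Y B.
Proof.
pose B : lmodType A := ((X : lmodType A) * (Y : lmodType A))%type.
exists B, (@lin_inl X Y : {linear _ -> B}), (@lin_inr X Y : {linear _ -> B}).
exists (fst : {linear B -> (X : lmodType A)}), (snd : {linear B -> (Y : lmodType A)}).
split; apply: lin_eq => x //=.
by case: x => x y; congr pair; rewrite /= ?addr0 ?add0r.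
Qed.

Definition Mod : addcat := Addcat Mod_zero Mod_biproduct.

Definition fin_generated (X : Mod) : Prop :=
  exists (m : nat) (e : 'I_m -> (X : lmodType A)),
    forall x, exists c : 'I_m -> A, x = \sum_(i < m) c i *: e i.

Lemma fg_zero : exists Z : Mod, is_zero Z /\ fin_generated Z.
Proof.
have [Z Z0] := Mod_zero; exists Z; split=> //; exists 0, (fun=> 0) => x.
exists (fun=> 0); rewrite big_ord0.
by have := congr1 (fun f : lin Z Z => (f : {linear Z -> Z}) x) Z0.
Qed.

Lemma fg_biproduct (X Y B : Mod) :
  fin_generated X -> fin_generated Y -> is_biproduct X Y B -> fin_generated B.
Proof.
move=> [m [e eP]] [n [d dP]] [i1 [i2 [p1 [p2 [_ _ _ _ h]]]]].
pose j1 : {linear _ -> _} := (i1 : lin X B); pose q1 : {linear _ -> _} := (p1 : lin B X).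
pose j2 : {linear _ -> _} := (i2 : lin Y B); pose q2 : {linear _ -> _} := (p2 : lin B Y).
exists (m + n)%N, (fun k => match split k with inl i => j1 (e i) | inr i => j2 (d i) end).
move=> x; have [a ha] := eP (q1 x); have [b hb] := dP (q2 x).
exists (fun k => match split k with inl i => a i | inr i => b i end).
have hx : j1 (q1 x) + j2 (q2 x) = x.
  by have := congr1 (fun f : lin B B => (f : {linear B -> B}) x) h.
rewrite -[LHS]hx ha hb !linear_sum big_split_ord /=; congr (_ + _).
  by apply: eq_bigr => i _; rewrite linearZ (unsplitK (inl i)).
by apply: eq_bigr => i _; rewrite linearZ (unsplitK (inr i)).
Qed.

Definition fg_class : additive_class Mod := AdditiveClass fg_zero fg_biproduct.

Definition fgMod : addcat := full fg_class.

Definition app (X Y : fgMod) (f : hom X Y) : {linear sval X -> sval Y} :=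
  (f : lin (sval X) (sval Y)).

Lemma app_comp (X Y Z : fgMod) (g : hom Y Z) (f : hom X Y) x :
  app (g \oc f) x = app g (app f x).
Proof. by []. Qed.

Lemma app_add (X Y : fgMod) (f g : hom X Y) x : app (f + g) x = app f x + app g x.
Proof. by []. Qed.

Lemma app_id (X : fgMod) x : app (idm X) x = x.
Proof. by []. Qed.

Lemma app_zero (X Y : fgMod) x : app (0 : hom X Y) x = 0.
Proof. by []. Qed.

End ModuleCategory.

Definition surjective (T U : Type) (f : T -> U) : Prop :=
  forall y, exists x, f x = y.

Definition is_ideal (R : comNzRingType) (I : R -> Prop) : Prop :=
  [/\ I 0, forall x y, I x -> I y -> I (x + y) & forall a x, I x -> I (a * x)].

Definition artinian (R : comNzRingType) : Prop :=
  forall I : nat -> R -> Prop,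
    (forall k, is_ideal (I k)) -> (forall k x, I k.+1 x -> I k x) ->
    exists m, forall k, (m <= k)%N -> forall x, I m x -> I k x.

Definition artin_algebra (R : comNzRingType) (L : algType R) : Prop :=
  artinian R /\ fin_generated (L : Mod R).

(* Right L-modules are left modules over the converse ring L^c. *)
Definition self_injective (R : comNzRingType) (L : algType R) : Prop :=
  injective_object ((L^c)^o : Mod L^c).

Section ClusterTilting.
Variable A : pzRingType.
Implicit Types X Y : fgMod A.

Definition is_projective_resolution X (P : nat -> fgMod A)
    (d : forall i, hom (P i.+1) (P i)) (e : hom (P 0) X) : Prop :=
  [/\ forall i, projective (P i),
      surjective (app e),
      forall x, app e x = 0 <-> exists y, x = app (d 0) y
    & forall i x, app (d i) x = 0 <-> exists y, x = app (d i.+1) y].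

(* Ext^k(X, Y) = 0, i.e. the complex Hom(P, Y) is exact in degree k for a
   projective resolution P of X. *)
Definition Ext_vanishes (k : nat) X Y : Prop :=
  exists (P : nat -> fgMod A) (d : forall i, hom (P i.+1) (P i)) (e : hom (P 0) X),
    is_projective_resolution d e /\
    match k with
    | 0 => forall f : hom (P 0) Y, f \oc d 0 = 0 -> f = 0
    | j.+1 => forall f : hom (P j.+1) Y, f \oc d j.+1 = 0 ->
        exists g : hom (P j) Y, f = g \oc d j
    end.

Variables (n : nat) (M : additive_family (fgMod A)).

Record n_cluster_tilting : Prop := NClusterTilting {
  right_approximation : forall X, exists i (f : hom (M i) X),
    forall j (g : hom (M j) X), exists h : hom (M j) (M i), g = f \oc h;
  left_approximation : forall X, exists i (f : hom X (M i)),
    forall j (g : hom X (M j)), exists h : hom (M i) (M j), g = h \oc f;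
  generating : forall X, exists i (f : hom (M i) X), surjective (app f);
  cogenerating : forall X, exists i (f : hom X (M i)), injective (app f);
  right_rigid : forall X, in_family M X <->
    forall i k, (0 < k < n)%N -> Ext_vanishes k (M i) X;
  left_rigid : forall X, in_family M X <->
    forall i k, (0 < k < n)%N -> Ext_vanishes k X (M i) }.

(* n-th syzygies are unique up to isomorphism and [in_family M] is invariant
   under isomorphism. *)
Definition nZ_cluster_tilting : Prop :=
  n_cluster_tilting /\
  forall i, exists K, is_nth_syzygy n (M i) K /\ in_family M K.

End ClusterTilting.

Section MonomorphismCategory.
Variables (A : pzRingType) (M : additive_family (fgMod A)).
Notation CM := (family_cat M).

Definition is_mono_arrow (F : arrows CM) : Prop := injective (app (fhom (arr F))).

Lemma mono_zero : exists Z : arrows CM, is_zero Z /\ is_mono_arrow Z.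
Proof.
have [Z Z0] := addcat_zero (arrows CM); exists Z; split; first exact: Z0.
have e : idm (M (src Z)) = 0.
  by rewrite -fhom_id (arrow_is_zero_src Z0) fhom_zero.
by move=> x y _; rewrite -[x]app_id -[y]app_id e !app_zero.
Qed.

Lemma mono_biproduct (F G B : arrows CM) :
  is_mono_arrow F -> is_mono_arrow G -> is_biproduct F G B -> is_mono_arrow B.
Proof.
move=> mF mG /arrow_biproduct_src[i1 [i2 [p1 [p2 e]]]] x y hxy.
have key (H : arrows CM) (q : square B H) : is_mono_arrow H ->
    app (fhom q.1) x = app (fhom q.1) y.
  move=> mH; apply: mH; rewrite -!app_comp -!fhom_comp square_comm.
  by rewrite fhom_comp !app_comp hxy.
have e2 z : app (fhom i1.1) (app (fhom p1.1) z)
          + app (fhom i2.1) (app (fhom p2.1) z) = z.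
  by rewrite -!app_comp -!fhom_comp -app_add -fhom_add e fhom_id app_id.
by rewrite -(e2 x) -(e2 y) (key F p1 mF) (key G p2 mG).
Qed.

Definition mono_class : additive_class (arrows CM) :=
  AdditiveClass mono_zero mono_biproduct.

(* This is S(M). *)
Definition mono_cat : addcat := full mono_class.

Definition ssrc (f : mono_cat) : idx M := src (sval f).
Definition stgt (f : mono_cat) : idx M := tgt (sval f).
Definition smap (f : mono_cat) : @hom CM (ssrc f) (stgt f) := arr (sval f).
Definition hom_src (f g : mono_cat) (a : hom f g) : @hom CM (ssrc f) (ssrc g) :=
  (a : square (sval f) (sval g)).1.
Definition hom_tgt (f g : mono_cat) (a : hom f g) : @hom CM (stgt f) (stgt g) :=
  (a : square (sval f) (sval g)).2.

(* the objects M -1-> M, 0 -> M, and M -> P with P projective *)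
Definition W_generator (f : mono_cat) : Prop :=
  [\/ exists i : family_cat M, sval f = Arrow (idm i),
      is_zero (M (ssrc f))
    | projective (M (stgt f))].

Definition W_class : additive_class mono_cat := additive_closure W_generator.

Definition under (F : umod_cat M) : presheaf M := sval (sval F).
Definition mod_nt (F G : mod_cat M) (s : hom F G) : nat_trans (sval F) (sval G) := s.
Definition umod_nt (F G : umod_cat M) (s : hom F G) :
  nat_trans (under F) (under G) := s.

(* Cokernels and n-exact completions are unique up to isomorphism and homotopy
   equivalence, so Upsilon and Psi are characterized rather than chosen. *)
Definition is_Upsilon (U : functor mono_cat (mod_cat M)) : Prop :=
  exists p : forall f : mono_cat, nat_trans (yoneda (stgt f)) (sval (U f)),
    (forall f, presents (fhom (smap f)) (p f)) /\
    (forall (f g : mono_cat) (a : hom f g) (Z : idx M) (u : hom (M Z) (M (stgt f))),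
       mod_nt (fmap U a) Z (p f Z u) = p g Z (fhom (hom_tgt a) \oc u)).

(* For f : M_1 -> M_2 the n-exact completion is
   M_1 -> M_2 -> T f 0 -> ... -> T f n.-1, so that M^n sits in degree n.+1. *)
Definition is_Psi (n : nat) (Psi : functor mono_cat (umod_cat M)) : Prop :=
  exists (T : mono_cat -> sequence_in CM) (c : forall f, hom (stgt f : CM) (T f 0)),
  let E f : sequence_in CM := splice (smap f) (c f) in
  exists p : forall f, nat_trans (yoneda (E f n.+1 : idx M)) (under (Psi f)),
    (forall f, n_exact n (E f) /\ presents (fhom (sq_d (E f) n)) (p f)) /\
    (forall (f g : mono_cat) (a : hom f g),
       exists phi : forall i, hom (E f i) (E g i),
         [/\ is_sq_map n phi, phi 0 = hom_src a, phi 1 = hom_tgt a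
           & forall (Z : idx M) (u : hom (M Z) (M (E f n.+1))),
               umod_nt (fmap Psi a) Z (p f Z u) = p g Z (fhom (phi n.+1) \oc u)]).

End MonomorphismCategory.

(* Main.v *)
Require Import Defs.
From HB Require Import structures.
From mathcomp Require Import all_boot all_algebra.
From mathcomp Require Import boolp.
Import Defs.
Set Implicit Arguments.
Unset Strict Implicit.
Unset Printing Implicit Defensive.
Import GRing.Theory.
Local Open Scope ring_scope.
Local Open Scope cat_scope.

(* Write St X for the functor of stable maps into X and let
   X_0 -f-> X_1 -> ... -> X_{n+1} be the n-exact completion of f.  With
   D_i := Coker (St X_i -> St X_{i+1}) we have D_0 = Phi f and D_n = Psi f, and the
   St X_i are projective.  The stabilised sequence stays exact at X_1, ..., X_n, so
   0 -> D_i -> St X_{i+2} -> D_{i+1} -> 0 is exact and Phi f is an n-th syzygy of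
   Psi f; naturality follows since lifts between such sequences are unique up to
   maps through projectives.

   Exactness at X_i comes down to the vanishing of the stable Hom groups
   Hom (X, Omega^j Y) for X, Y in M and 0 < j < n: as Omega is fully faithful on
   stable maps (projectives are injective), this group is Ext^(n-j) (X, Omega^n Y),
   and Omega^n Y is in M. *)

(** * Syzygies in additive categories *)

(** The overview leaves out why both functors respect the ideals. The hard generators of [W] are M
    -> P with P projective: [Psi] sends them to projectives because the identity of the completed
    sequence is null-homotopic modulo projectives, and building this homotopy takes exactness of
    stable Hom (-, Y), whereas the syzygy sequences take exactness of stable Hom (T, -). In both
    variances the sequence is cut at its images, and vanishing is carried inwards from an end where
    the image is a term of the sequence: the left end uses that X_0 -> X_1 is injective, the right
    end that X_n -> X_{n+1} is surjective, which follows from [Psi f] vanishing on projectives. The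
    intermediate cokernels are not functors on S(M), since a square lifts to the completed sequences
    in many ways; naturality is therefore carried by a relation between maps induced by one common
    chain map. *)

Lemma projective_is_zero (C : precat) (X : C) : is_zero X -> projective X.
Proof. by move=> X0 Y Z e _ f; exists 0; rewrite compm0 -[f]compm1 X0 compm0. Qed.

Lemma projective_retract (C : precat) (X Y : C) (s : hom X Y) (r : hom Y X) :
  r \oc s = idm X -> projective Y -> projective X.
Proof.
move=> rs pY U V e epi_e f; have [g hg] := pY _ _ e epi_e (f \oc r).
by exists (g \oc s); rewrite compA -hg -compA rs compm1.
Qed.

Section Syzygies.
Variable C : addcat.
Implicit Types X K Q : C.

Definition syzygy_seq K Q X (k : hom K Q) (e : hom Q X) : Prop :=
  [/\ projective Q, epi e & is_kernel k e].

(** [w] is a syzygy of [x]. The middle map stays existential because only the stable class of [w]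
    matters. *)
Definition covers K Q X (k : hom K Q) (e : hom Q X)
    K' Q' X' (k' : hom K' Q') (e' : hom Q' X') (x : hom X X') (w : hom K K') :=
  exists q : hom Q Q', e' \oc q = x \oc e /\ k' \oc w = q \oc k.

(* Typing stable classes in [stable C] once and for all keeps conversion from
   unfolding the quotient category. *)
Definition stab X Y (f : hom X Y) : @hom (stable C) X Y :=
  qpi (factor_ideal (projectives C)) f.

Lemma stab_comp X Y Z (g : hom Y Z) (f : hom X Y) : stab g \oc stab f = stab (g \oc f).
Proof. exact: qcomp_pi. Qed.

Lemma stable_eqP X Y (f g : hom X Y) :
  stab f = stab g <-> factors_through (projectives C) (f - g).
Proof.
by split=> [/qpiP /asboolP|h]; last by apply/qpiP/asboolP.
Qed.

Section Cover.
Variables (K Q X : C) (k : hom K Q) (e : hom Q X).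
Variables (K' Q' X' : C) (k' : hom K' Q') (e' : hom Q' X').
Hypotheses (s : syzygy_seq k e) (s' : syzygy_seq k' e').

Lemma covers_exists (x : hom X X') : exists w, covers k e k' e' x w.
Proof.
case: s s' => [pQ _ [ek _]] [_ epi' [_ ker']].
have [q hq] := pQ _ _ e' epi' (x \oc e).
have [|w [hw _]] := ker' _ (q \oc k).
  by rewrite compA -hq -compA ek compm0.
by exists w, q.
Qed.

(* Two lifts of the same map differ by a map [h \oc k] through Q; a map through a
   projective lifts along [e'], hence has the zero map as a cover. *)
Lemma covers_stable (x y : hom X X') (w v : hom K K') :
  stab x = stab y -> covers k e k' e' x w -> covers k e k' e' y v -> stab w = stab v.
Proof.
case: s s' => [pQ _ [ek _]] [_ epi' [ek' ker']].
move=> /stable_eqP[Z [pZ [g [h xy]]]] [q [hq1 hq2]] [r [hr1 hr2]].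
have [h' hh'] := pZ _ _ e' epi' h.
have [|u [hu _]] := ker' _ (q - r - h' \oc g \oc e).
  by rewrite !compBr hq1 hr1 -compBl xy !compA hh' subrr.
apply/stable_eqP; exists Q; split=> //; exists k, u.
have [|z [_ zu]] := ker' _ (k' \oc (w - v)); first by rewrite compA ek' comp0m.
rewrite -(zu (w - v)) //; apply: zu.
rewrite compA -hu !compBl -!compA ek !compm0 subr0.
by rewrite compBr hq2 hr2.
Qed.

End Cover.

Lemma covers_id K Q X (k : hom K Q) (e : hom Q X) :
  covers k e k e (idm X) (idm K).
Proof. by exists (idm Q); rewrite comp1m !compm1 comp1m. Qed.

Lemma covers_comp K Q X (k : hom K Q) (e : hom Q X)
    K' Q' X' (k' : hom K' Q') (e' : hom Q' X')
    K'' Q'' X'' (k'' : hom K'' Q'') (e'' : hom Q'' X'')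
    (y : hom X' X'') (x : hom X X') (v : hom K' K'') (w : hom K K') :
  covers k' e' k'' e'' y v -> covers k e k' e' x w ->
  covers k e k'' e'' (y \oc x) (v \oc w).
Proof.
move=> [r [r1 r2]] [q [q1 q2]]; exists (r \oc q); split.
  by rewrite compA r1 -compA q1 compA.
by rewrite compA r2 -compA q2 compA.
Qed.

Lemma stab_iso X Y (f : hom X Y) (g : hom Y X) :
  stab (g \oc f) = stab (idm X) -> stab (f \oc g) = stab (idm Y) ->
  iso (stab f).
Proof. by move=> h1 h2; exists (stab g); rewrite !stab_comp h1 h2. Qed.

(** Schanuel's lemma in stable form: the identity is also covered in the opposite direction, and
    both composites cover identities, so [covers_stable] applies to each. *)
Lemma covers_iso K Q X (k : hom K Q) (e : hom Q X)
    K' Q' (k' : hom K' Q') (e' : hom Q' X) (w : hom K K') :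
  syzygy_seq k e -> syzygy_seq k' e' -> covers k e k' e' (idm X) w ->
  iso (stab w).
Proof.
move=> s s' cw; have [v cv] := covers_exists s' s (idm X).
have c1 := covers_comp cv cw; have c2 := covers_comp cw cv.
rewrite comp1m in c1; rewrite comp1m in c2.
apply: (stab_iso (g := v)).
- exact: (covers_stable s s erefl c1 (covers_id _ _)).
- exact: (covers_stable s' s' erefl c2 (covers_id _ _)).
Qed.

End Syzygies.

Section StableFunctor.
Variables C D : precat.

Lemma iso_comp (X Y Z : C) (g : hom Y Z) (f : hom X Y) :
  iso g -> iso f -> iso (g \oc f).
Proof.
move=> [g' [g1 g2]] [f' [f1 f2]]; exists (f' \oc g'); split.
  by rewrite -compA (compA g') g1 comp1m.
by rewrite -compA (compA f) f2 comp1m.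
Qed.

Lemma fmap_iso (F : functor C D) (X Y : C) (f : hom X Y) :
  iso f -> iso (fmap F f).
Proof. by move=> [g [g1 g2]]; exists (fmap F g); rewrite -!fmapM g1 g2 !fmap1. Qed.

End StableFunctor.

(** * Maps that factor through projective-injective modules *)

Section LinearMaps.
Variable A : pzRingType.
Implicit Types K N P Q R S T U V W X Y Z : lmodType A.

Lemma linear_of_fun U V (f : U -> V) :
  (forall a x y, f (a *: x + y) = a *: f x + f y) ->
  exists g : {linear U -> V}, g =1 f.
Proof.
move=> hf; pose L := GRing.isLinear.Build A U V *:%R f hf.
by exists (HB.pack_for {linear U -> V} f L).
Qed.

Lemma linear_lift U V W (i : {linear V -> W}) (t : {linear U -> W}) :
  injective i -> (forall x, exists y, t x = i y) ->
  exists s : {linear U -> V}, forall x, i (s x) = t x.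
Proof.
move=> inj_i /choice[s hs].
have [|g hg] := @linear_of_fun U V s.
  by move=> a x y; apply: inj_i; rewrite linearP -!hs linearP.
by exists g => x; rewrite hg -hs.
Qed.

Lemma linear_descend U V W (p : {linear U -> V}) (t : {linear U -> W}) :
  surjective p -> (forall x, p x = 0 -> t x = 0) ->
  exists s : {linear V -> W}, forall x, s (p x) = t x.
Proof.
move=> /choice[r hr] h0.
have ht x y : p x = p y -> t x = t y.
  by move=> e; apply/eqP; rewrite -subr_eq0 -linearB h0 // linearB e subrr.
have [|g hg] := @linear_of_fun V W (t \o r).
  move=> a x y; rewrite /= -linearP; apply: ht.
  by rewrite linearP !hr.
by exists g => x; rewrite hg; apply: ht; rewrite hr.
Qed.

Section Submodule.
Variables (V : lmodType A) (S : V -> Prop).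
Hypotheses (S0 : S 0) (SP : forall a x y, S x -> S y -> S (a *: x + y)).

Let S_pred : {pred V} := fun x => `[< S x >].

Let S_closed : submod_closed S_pred.
Proof.
split; first exact/asboolP.
by move=> a x y /asboolP hx /asboolP hy; apply/asboolP/SP.
Qed.

HB.instance Definition _ := GRing.isSubmodClosed.Build A V S_pred S_closed.

Let sub_type := {x : V | x \in S_pred}.
HB.instance Definition _ := [Choice of sub_type by <:].
HB.instance Definition _ := [isSub of sub_type for @sval V _].
HB.instance Definition _ := [SubChoice_isSubLmodule of sub_type by <:].

Lemma submodule_exists : exists (K : lmodType A) (i : {linear K -> V}),
  injective i /\ forall x, S x <-> exists k, x = i k.
Proof.
exists sub_type, (val : {linear sub_type -> V}); split; first exact: val_inj.
move=> x; split=> [/asboolP Sx|[[y Sy] ->]]; first by exists (exist _ x Sx).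
exact/asboolP.
Qed.

End Submodule.

Definition ses U V W (i : {linear U -> V}) (p : {linear V -> W}) : Prop :=
  [/\ injective i, surjective p & forall x, p x = 0 <-> exists y, x = i y].

Lemma kernel_exists V W (p : {linear V -> W}) : surjective p ->
  exists K (i : {linear K -> V}), ses i p.
Proof.
have [||K [i [inj_i iP]]] := @submodule_exists V (fun x => p x = 0).
- by rewrite linear0.
- by move=> a x y hx hy; rewrite linearP hx hy scaler0 addr0.
by move=> surj_p; exists K, i; split.
Qed.

Lemma image_exists V W (f : {linear V -> W}) :
  exists K (i : {linear K -> W}) (p : {linear V -> K}),
    [/\ injective i, surjective p & forall x, f x = i (p x)].
Proof.
have [||K [i [inj_i iP]]] := @submodule_exists W (fun y => exists x, y = f x).
- by exists 0; rewrite linear0.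
- by move=> a _ _ [x ->] [y ->]; exists (a *: x + y); rewrite linearP.
have [|p hp] := @linear_lift V K W i f inj_i.
  by move=> x; apply/iP; exists x.
exists K, i, p; split=> // k.
have [x hx] : exists x, i k = f x by apply/iP; exists k.
by exists x; apply: inj_i; rewrite hp.
Qed.

Lemma ses_comp0 U V W (i : {linear U -> V}) (p : {linear V -> W}) :
  ses i p -> forall x, p (i x) = 0.
Proof. by case=> _ _ h x; apply/h; exists x. Qed.

Lemma ses_lift T U V W (i : {linear U -> V}) (p : {linear V -> W})
    (t : {linear T -> V}) : ses i p -> (forall x, p (t x) = 0) ->
  exists s : {linear T -> U}, forall x, i (s x) = t x.
Proof. by move=> [inj_i _ ex] h; apply: linear_lift => // x; apply/ex. Qed.

Lemma ses_descend T U V W (i : {linear U -> V}) (p : {linear V -> W})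
    (t : {linear V -> T}) : ses i p -> (forall x, t (i x) = 0) ->
  exists s : {linear W -> T}, forall x, s (p x) = t x.
Proof.
by move=> [_ surj_p ex] h; apply: linear_descend => // x /ex[y ->].
Qed.

(** Both properties are tested against all modules, because kernels and images enter below without a
    proof that they are finitely generated. *)
Definition proj_inj Q : Prop :=
  (forall Y Z (e : {linear Y -> Z}) (f : {linear Q -> Z}), surjective e ->
     exists g : {linear Q -> Y}, forall x, e (g x) = f x) /\
  (forall Y Z (m : {linear Y -> Z}) (f : {linear Y -> Q}), injective m ->
     exists g : {linear Z -> Q}, forall x, g (m x) = f x).

Lemma proj_inj_retract P Q (s : {linear P -> Q}) (r : {linear Q -> P}) :
  (forall x, r (s x) = x) -> proj_inj Q -> proj_inj P.
Proof.
move=> rs [pQ iQ]; split=> [Y Z e f se | Y Z m f im].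
  have [g hg] := pQ _ _ e (f \o r) se.
  by exists (g \o s) => x; rewrite /= hg /= rs.
have [g hg] := iQ _ _ m (s \o f) im.
by exists (r \o g) => x; rewrite /= hg /= rs.
Qed.

Lemma proj_inj_prod P Q : proj_inj P -> proj_inj Q -> proj_inj (P * Q : lmodType A)%type.
Proof.
move=> [pP iP] [pQ iQ]; split=> [Y Z e f se | Y Z m f im].
  have [g hg] := pP _ _ e (f \o @lin_inl A P Q) se.
  have [h hh] := pQ _ _ e (f \o @lin_inr A P Q) se.
  exists ((g \o fst) \+ (h \o snd)) => -[x y] /=.
  rewrite linearD hg hh /= -linearD; congr (f _).
  by congr pair; rewrite /= ?addr0 ?add0r.
have [g hg] := iP _ _ m (fst \o f) im.
have [h hh] := iQ _ _ m (snd \o f) im.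
exists ((@lin_inl A P Q \o g) \+ (@lin_inr A P Q \o h)) => x /=.
rewrite hg hh /=; case: (f x) => a b /=.
by congr pair; rewrite /= ?addr0 ?add0r.
Qed.

(* Over a self-injective algebra every finitely generated projective is [proj_inj]
   (see [projective_proj_inj]), so this is vanishing in the stable category; nothing is
   required to be finitely generated, so kernels always exist. *)
Definition pz U V (t : {linear U -> V}) : Prop :=
  exists Q, proj_inj Q /\ exists (a : {linear U -> Q}) (b : {linear Q -> V}),
    forall x, t x = b (a x).

Lemma pz_eq U V (s t : {linear U -> V}) : s =1 t -> pz t -> pz s.
Proof.
by move=> e [Q [gQ [a [b h]]]]; exists Q; split=> //; exists a, b => x; rewrite e.
Qed.

Lemma pz_compl U V W (g : {linear V -> W}) (t : {linear U -> V}) :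
  pz t -> pz (g \o t).
Proof.
move=> [Q [gQ [a [b h]]]]; exists Q; split=> //; exists a, (g \o b) => x /=.
by rewrite h.
Qed.

Lemma pz_compr U V W (t : {linear V -> W}) (f : {linear U -> V}) :
  pz t -> pz (t \o f).
Proof.
move=> [Q [gQ [a [b h]]]]; exists Q; split=> //; exists (a \o f), b => x /=.
by rewrite h.
Qed.

Lemma pz_add U V (s t : {linear U -> V}) : pz s -> pz t -> pz (s \+ t).
Proof.
move=> [P [gP [a [b h]]]] [Q [gQ [c [d k]]]].
exists (P * Q : lmodType A)%type; split; first exact: proj_inj_prod.
exists ((@lin_inl A P Q \o a) \+ (@lin_inr A P Q \o c)), ((b \o fst) \+ (d \o snd)).
by move=> x; rewrite /= h k addr0 add0r.
Qed.

Definition hom0 U V := forall t : {linear U -> V}, pz t.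

Lemma pz_proj_inj_src Q V (t : {linear Q -> V}) : proj_inj Q -> pz t.
Proof. by move=> gQ; exists Q; split=> //; exists idfun, t. Qed.

Lemma pz_lift U V P (e : {linear P -> V}) (t : {linear U -> V}) :
  surjective e -> pz t ->
  exists s : {linear U -> P}, pz s /\ forall x, t x = e (s x).
Proof.
move=> se [Q [gQ [a [b h]]]]; have [g hg] := gQ.1 _ _ e b se.
exists (g \o a); split; last by move=> x; rewrite /= hg h.
by exists Q; split=> //; exists a, g.
Qed.

Lemma pz_extend U V W (m : {linear U -> V}) (t : {linear U -> W}) :
  injective m -> pz t -> exists s : {linear V -> W}, pz s /\ forall x, t x = s (m x).
Proof.
move=> im [Q [gQ [a [b h]]]]; have [g hg] := gQ.2 _ _ m a im.
exists (b \o g); split; last by move=> x; rewrite /= hg h.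
by exists Q; split=> //; exists g, b.
Qed.

(* Rotating the triangle: [t \o p] lifts to Q along [e], and its restriction to U
   lands in [Y'] where it is stably zero, hence is the restriction of a map
   V -> Y'; subtracting the latter gives a map that descends to W. *)
Lemma pz_descend U V W (i : {linear U -> V}) (p : {linear V -> W})
    Y' Q Y (k : {linear Y' -> Q}) (e : {linear Q -> Y}) (t : {linear W -> Y}) :
  ses i p -> proj_inj Q -> ses k e -> hom0 U Y' -> pz (t \o p) -> pz t.
Proof.
move=> sip gQ ske h0 /(pz_lift (let: And3 _ se _ := ske in se))[g [_ hg]].
have [|s hs] := @ses_lift U Y' Q Y k e (g \o i) ske.
  by move=> x; rewrite /= -hg /= (ses_comp0 sip) linear0.
have [inj_i _ _] := sip.
have [s' [_ hs']] := pz_extend inj_i (h0 s).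
have [|z hz] := @ses_descend Q U V W i p (g \- (k \o s')) sip.
  by move=> x; rewrite /= -hs' hs /= subrr.
exists Q; split=> //; exists z, e.
have [_ surj_p _] := sip.
move=> y; have [x <-] := surj_p y.
rewrite hz /= linearB (ses_comp0 ske) subr0 -hg //.
Qed.

Lemma hom0_descend U V W (i : {linear U -> V}) (p : {linear V -> W})
    Y' Q Y (k : {linear Y' -> Q}) (e : {linear Q -> Y}) :
  ses i p -> proj_inj Q -> ses k e -> hom0 U Y' -> hom0 V Y -> hom0 W Y.
Proof. by move=> sip gQ ske h0 h t; apply: (pz_descend sip gQ ske h0). Qed.

(** The dual rotation: up to a map through R, [t] factors as T -> W' -> U with connecting map [d],
    and stable Hom (T, W') vanishes. *)
Lemma pz_lift_ses T U V W (i : {linear U -> V}) (p : {linear V -> W})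
    W' Q (k : {linear W' -> Q}) (e : {linear Q -> W}) (t : {linear T -> U}) :
  ses i p -> proj_inj Q -> ses k e -> hom0 T W' -> pz (i \o t) -> pz t.
Proof.
move=> sip gQ ske h0 [R [gR [a [b hab]]]].
have [_ surj_p _] := sip; have [_ surj_e _] := ske.
have [l hl] := gQ.1 _ _ p e surj_p.
have [c hc] := gR.1 _ _ e (p \o b) surj_e.
have [|z hz] := @ses_lift R U V W i p (b \- (l \o c)) sip.
  by move=> x; rewrite /= linearB hl hc /= subrr.
have [|s hs] := @ses_lift T W' Q W k e (c \o a) ske.
  by move=> x; rewrite /= hc /= -hab /= (ses_comp0 sip).
have [|d hd] := @ses_lift W' U V W i p (l \o k) sip.
  by move=> x; rewrite /= hl (ses_comp0 ske).
apply: (@pz_eq _ _ _ ((d \o s) \+ (z \o a))); last first.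
  apply: pz_add; first exact: pz_compl.
  by apply: pz_compr; apply: pz_proj_inj_src.
have [inj_i _ _] := sip.
move=> x; apply: inj_i; rewrite /= linearD hd hz /= hs /=.
by rewrite addrC subrK -hab.
Qed.

(* The syzygy functor is faithful on stable Hom groups. *)
Lemma hom0_syzygy S S' P T T' Q (i : {linear S' -> P}) (p : {linear P -> S})
    (k : {linear T' -> Q}) (e : {linear Q -> T}) :
  proj_inj P -> ses i p -> proj_inj Q -> ses k e -> hom0 S' T' -> hom0 S T.
Proof. by move=> gP sip gQ ske h t; apply: (pz_descend sip gQ ske h); apply: pz_proj_inj_src. Qed.

(* Stable Hom (X, Omega^j N) = 0, for some choice of the syzygies of N. *)
Fixpoint syz_hom0 (j : nat) X N : Prop :=
  if j is k.+1 then
    exists P N' (i : {linear N' -> P}) (e : {linear P -> N}),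
      [/\ proj_inj P, ses i e & syz_hom0 k X N']
  else hom0 X N.

Lemma syz_hom0_iso j X N N' (f : {linear N -> N'}) :
  injective f -> surjective f -> syz_hom0 j X N -> syz_hom0 j X N'.
Proof.
case: j => [|j] inj_f surj_f /=.
  move=> h t; have [|s hs] := @linear_lift X N N' f t inj_f.
    by move=> x; have [y <-] := surj_f (t x); exists y.
  by apply: (@pz_eq _ _ _ (f \o s)) => [x|]; [rewrite -hs | apply: pz_compl].
move=> [P [K [i [e [gP [inj_i surj_e ex] oK]]]]].
exists P, K, i, (f \o e); split=> //; split=> //.
  move=> y; have [z <-] := surj_f y; have [x <-] := surj_e z.
  by exists x.
move=> x; rewrite -ex /=; split=> [h|->]; last by rewrite linear0.
by apply: inj_f; rewrite h linear0.
Qed.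

Lemma hom0_middle X U V W (i : {linear U -> V}) (p : {linear V -> W}) :
  ses i p -> hom0 X U -> hom0 X W -> hom0 X V.
Proof.
move=> sip hU hW t; have [_ surj_p _] := sip.
have [Q [gQ [a [b hab]]]] := hW (p \o t).
have [c hc] := gQ.1 _ _ p b surj_p.
have [|s hs] := @ses_lift X U V W i p (t \- (c \o a)) sip.
  by move=> x; rewrite /= linearB hc -hab subrr.
apply: (@pz_eq _ _ _ ((i \o s) \+ (c \o a))).
  by move=> x; rewrite /= hs /= subrK.
apply: pz_add; first exact: pz_compl.
by apply: pz_compr; apply: pz_proj_inj_src.
Qed.

(* Horseshoe lemma. *)
Lemma syz_hom0_middle j X U V W (i : {linear U -> V}) (p : {linear V -> W}) :
  ses i p -> syz_hom0 j X U -> syz_hom0 j X W -> syz_hom0 j X V.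
Proof.
elim: j U V W i p => [|j IHj] U V W i p sip; first exact: hom0_middle sip.
move=> [P [U' [iU [eU [gP sU oU]]]]] [Q [W' [iW [eW [gQ sW oW]]]]].
have [inj_i surj_p ex] := sip.
have [inj_iU surj_eU exU] := sU; have [inj_iW surj_eW exW] := sW.
have [l hl] := gQ.1 _ _ p eW surj_p.
pose PQ : lmodType A := (P * Q)%type.
pose e : {linear PQ -> V} := (i \o eU \o fst) \+ (l \o snd).
have eE x y : e (x, y) = i (eU x) + l y by [].
have surj_e : surjective e.
  move=> v; have [y hy] := surj_eW (p v).
  have /ex[u hu] : p (v - l y) = 0 by rewrite linearB hl hy subrr.
  by have [x hx] := surj_eU u; exists (x, y); rewrite eE hx -hu subrK.
have [V' [iV sV]] := kernel_exists surj_e; have [inj_iV _ exV] := sV.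
have [|a ha] := @ses_lift U' V' PQ V iV e (@lin_inl A P Q \o iU) sV.
  by move=> x; rewrite eE (ses_comp0 sU) !linear0 addr0.
have [|b hb] := @ses_lift V' W' Q W iW eW (snd \o iV) sW.
  move=> x; suff: eW (iV x).2 = 0 by [].
  have := ses_comp0 sV x; case: (iV x) => u w; rewrite eE => /(congr1 p).
  by rewrite linearD (ses_comp0 sip) add0r hl linear0.
exists PQ, V', iV, e; split=> //; first exact: proj_inj_prod.
apply: (IHj _ _ _ a b) => //; split.
- move=> x y /(congr1 iV); rewrite !ha /= => -[].
  exact: inj_iU.
- move=> w; have /ex[u hu] : p (l (iW w)) = 0 by rewrite hl (ses_comp0 sW).
  have [x hx] := surj_eU (- u).
  have /exV[v hv] : e (x, iW w) = 0 by rewrite eE hx hu linearN addNr.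
  by exists v; apply: inj_iW; rewrite hb /= -hv.
- move=> v; split=> [bv|[x ->]]; last first.
    by apply: inj_iW; rewrite hb /= ha /= linear0.
  have h2 : (iV v).2 = 0 by rewrite -[LHS]hb bv linear0.
  have := ses_comp0 sV v; move: h2; case hv: (iV v) => [x y] h2.
  rewrite [y]h2 eE linear0 addr0 -(linear0 i) => /inj_i /exU[u hu].
  exists u; apply: inj_iV; rewrite ha hv [y]h2 hu.
  by [].
Qed.

(* From [0 -> U -> V -> W -> 0] and [0 -> W' -> Q -> W -> 0] one gets the
   pullback sequence [0 -> W' -> U + Q -> V -> 0]. *)
Lemma syz_hom0_left j X U V W (i : {linear U -> V}) (p : {linear V -> W}) :
  ses i p -> syz_hom0 j X V -> syz_hom0 j.+1 X W -> syz_hom0 j X U.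
Proof.
move=> sip oV [Q [W' [k [e [gQ ske oW]]]]].
have [inj_i surj_p ex] := sip; have [inj_k surj_e exk] := ske.
have [l hl] := gQ.1 _ _ p e surj_p.
pose UQ : lmodType A := (U * Q)%type.
have [|d hd] := @ses_lift W' U V W i p (l \o k) sip.
  by move=> x; rewrite /= hl (ses_comp0 ske).
pose m : {linear W' -> UQ} := (@lin_inr A U Q \o k) \- (@lin_inl A U Q \o d).
have mE x : m x = (- d x, k x) by congr pair; rewrite /= ?sub0r ?subr0.
pose r : {linear UQ -> V} := (i \o fst) \+ (l \o snd).
have rE u q : r (u, q) = i u + l q by [].
have smr : ses m r.
  split.
  - by move=> x y; rewrite !mE => -[_ /inj_k].
  - move=> v; have [q hq] := surj_e (p v).
    have /ex[u hu] : p (v - l q) = 0 by rewrite linearB hl hq subrr.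
    by exists (u, q); rewrite rE -hu subrK.
  - move=> [u q]; rewrite rE; split=> [h|[x]]; last first.
      by rewrite mE => -[-> ->]; rewrite linearN hd addNr.
    have := congr1 p h.
    rewrite linearD (ses_comp0 sip) add0r hl linear0 => /exk[x hx].
    exists x; rewrite mE -hx; congr pair; apply: inj_i.
    by apply/eqP; rewrite linearN hd /= -hx -addr_eq0 h.
have := syz_hom0_middle smr oW oV.
case: j {oV oW} => [|j] /=.
  move=> h t; have := pz_compl fst (h (@lin_inl A U Q \o t)).
  by apply: pz_eq.
(* U and U + Q have the same syzygies: P' is the kernel of the split surjection P -> Q, hence a
   retract of P, and it covers U with the same kernel K. *)
move=> [P [K [a [b [gP [inj_a surj_b exb] oK]]]]].
have surj_q : surjective (snd \o b).
  by move=> q; have [x hx] := surj_b (0, q); exists x; rewrite /= hx.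
have [P' [c sc]] := kernel_exists surj_q; have [inj_c _ exc] := sc.
have [s hs] := gQ.1 _ _ (snd \o b) idfun surj_q.
have [|r' hr'] := @ses_lift P P' P Q c (snd \o b) (idfun \- (s \o (snd \o b))) sc.
  by move=> x; rewrite /= linearB /= [X in _ - X]hs subrr.
have [|a' ha'] := @ses_lift K P' P Q c (snd \o b) a sc.
  move=> x; rewrite /=; have -> : b (a x) = 0 by apply/exb; exists x.
  by [].
exists P', K, a', (fst \o b \o c); split=> //.
  apply: (proj_inj_retract (s := c) (r := r')) => // x; apply: inj_c.
  by rewrite hr' /= [snd _](ses_comp0 sc) linear0 subr0.
split.
- by move=> x y /(congr1 c); rewrite !ha' => /inj_a.
- move=> u; have [x hx] := surj_b (u, 0).
  have /exc[y hy] : (snd \o b) x = 0 by rewrite /= hx.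
  by exists y; rewrite /= -hy hx.
- move=> x; split=> [h|[y ->]]; last first.
    by rewrite /= ha'; have -> : b (a y) = 0 by apply/exb; exists y.
  have /exb[y hy] : b (c x) = 0.
    move: h (ses_comp0 sc x) => /=.
    by case: (b (c x)) => u q /= -> ->.
  by exists y; apply: inj_c; rewrite ha'.
Qed.

End LinearMaps.

(** * Exact sequences modulo projectives *)

Section Chains.
Variable A : pzRingType.
Implicit Types K N P Q R S T U V W X Y Z : lmodType A.

(** Dimension shift: Ext^(m+1) (X, N (m+1)) = 0 kills stable Hom (X, N 0). Each step passes to the
    syzygy K of X and to the tail of N by [hom0_syzygy]; for m = 0 a map K -> N 1 extends to P 0 by
    the Ext^1 condition. *)
Lemma resolution_hom0 (m : nat) X (P N Q : nat -> lmodType A)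
    (d : forall i, {linear P i.+1 -> P i}) (e : {linear P 0 -> X})
    (k : forall j, {linear N j.+1 -> Q j}) (c : forall j, {linear Q j -> N j}) :
  (forall i, proj_inj (P i)) -> surjective e ->
  (forall x, e x = 0 <-> exists y, x = d 0 y) ->
  (forall i x, d i x = 0 <-> exists y, x = d i.+1 y) ->
  (forall j, (j <= m)%N -> proj_inj (Q j) /\ ses (k j) (c j)) ->
  (forall f : {linear P m.+1 -> N m.+1}, (forall x, f (d m.+1 x) = 0) ->
     exists g : {linear P m -> N m.+1}, forall x, f x = g (d m x)) ->
  hom0 X (N 0).
Proof.
elim: m X P N Q d e k c => [|m IHm] X P N Q d e k c gP surj_e ex0 ex hc van.
all: have [K [i sie]] := kernel_exists surj_e.
all: have [|p hp] := @ses_lift A (P 1) K (P 0) X i e (d 0) sie;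
  first by move=> x; apply/ex0; exists x.
all: have [inj_i _ exi] := sie; have [//|gQ skc] := hc 0%N.
all: have surj_p : surjective p by
  move=> y; have /ex0[x hx] := ses_comp0 sie y; exists x; apply: inj_i; rewrite hp.
all: have exp x : p x = 0 <-> exists y, x = d 1 y by
  rewrite -ex; split=> [h|h]; [rewrite -hp h linear0 | apply: inj_i; rewrite hp h linear0].
  apply: (hom0_syzygy (gP 0) sie gQ skc) => t.
  have [|g hg] := van (t \o p).
    move=> x; rewrite /=; have -> : p (d 1 x) = 0 by apply/exp; exists x.
    by rewrite linear0.
  exists (P 0); split=> //; exists i, g => y.
  by have [x <-] := surj_p y; rewrite hp -hg.
apply: (hom0_syzygy (gP 0) sie gQ skc).
apply: (IHm K (P \o S) (N \o S) (Q \o S) (fun i => d i.+1) p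
  (fun j => k j.+1) (fun j => c j.+1)).
- by move=> i'; apply: gP.
- exact: surj_p.
- exact: exp.
- by move=> i' x; apply: ex.
- by move=> j jm; apply: hc.
- exact: van.
Qed.

Section Sequence.
Variables (n : nat) (X : nat -> lmodType A) (d : forall k, {linear X k -> X k.+1}).
Hypotheses (inj_d : injective (d 0)) (surj_d : surjective (d n))
  (ex_d : forall k, (k < n)%N -> forall x, d k.+1 x = 0 <-> exists y, x = d k y).

(** K k is the image of [d k], with inclusion [i k] and corestriction [p k], so that K k -> X (k+1)
    -> K (k+1) is short exact for k < n. *)
Let H1 k := cid (image_exists (d k)).
Let K k := sval (H1 k).
Let H2 k := cid (svalP (H1 k)).
Let i k : {linear K k -> X k.+1} := sval (H2 k).
Let H3 k := cid (svalP (H2 k)).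
Let p k : {linear X k -> K k} := sval (H3 k).

Let inj_i k : injective (i k).
Proof. by have [] := svalP (H3 k). Qed.
Let surj_p k : surjective (p k).
Proof. by have [] := svalP (H3 k). Qed.
Let dE k x : d k x = i k (p k x).
Proof. by have [] := svalP (H3 k). Qed.

Let ses_ip k : (k < n)%N -> ses (i k) (p k.+1).
Proof.
move=> kn; split=> // x; split=> [h|[y ->]].
  have /(ex_d kn)[y ->] : d k.+1 x = 0 by rewrite dE h linear0.
  by exists (p k y); rewrite dE.
have [z <-] := @surj_p k y; apply: (@inj_i k.+1); rewrite -!dE linear0.
by apply/(ex_d kn); exists z.
Qed.

Section Contravariant.
Variables (N Q : nat -> lmodType A).
Variables (k : forall j, {linear N j.+1 -> Q j}) (c : forall j, {linear Q j -> N j}).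
Hypotheses (hc : forall j, (j < n)%N -> proj_inj (Q j) /\ ses (k j) (c j))
  (h0 : forall k j, (0 < j < n)%N -> hom0 (X k) (N j)).

(** Induction from the left end, where K 0 is X 0 because [d 0] is injective. Each further image
    costs one more syzygy of the target, whence the bound m + l < n. *)
Let hom0_image l m : (0 < m)%N -> (m + l < n)%N -> hom0 (K l) (N m).
Proof.
elim: l m => [|l IHl] m m0 mn.
  move=> t; have [|s hs] := @linear_descend A _ _ _ (p 0) idfun (@surj_p 0).
    by move=> x h; apply: inj_d; rewrite dE h !linear0.
  apply: (@pz_eq _ _ _ _ ((t \o p 0) \o s)).
    by move=> y; have [x <-] := @surj_p 0 y; rewrite /= hs.
  by apply: pz_compr; apply: h0; rewrite m0 -[m]addn0.
have [gQ skc] : proj_inj (Q m) /\ ses (k m) (c m).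
  by apply: hc; apply: leq_trans mn; rewrite ltnS leq_addr.
apply: (hom0_descend (ses_ip (k := l) _) gQ skc).
- by apply: leq_trans mn; rewrite addnS ltnS ltnW // ltnS leq_addl.
- by apply: IHl => //; rewrite addSn -addnS.
- by apply: h0; rewrite m0 (leq_ltn_trans _ mn) // leq_addr.
Qed.

(** By [pz_descend] the restriction of [u] to K (l+1) is stably zero, so it extends to a stably zero
    map on X (l+2). Subtracting that map leaves one that vanishes on the image outright, to which
    the unstable exactness [hY] applies. *)
Lemma contravariant_pz_exact l (u : {linear X l.+2 -> N 0}) : (l.+2 <= n)%N ->
  (forall w : {linear X l.+2 -> N 0}, (forall x, w (d l.+1 x) = 0) ->
     exists v : {linear X l.+3 -> N 0}, forall x, w x = v (d l.+2 x)) ->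
  pz (u \o d l.+1) -> exists v : {linear X l.+3 -> N 0}, pz (u \- (v \o d l.+2)).
Proof.
move=> ln hY hu; have [gQ skc] : proj_inj (Q 0) /\ ses (k 0) (c 0).
  by apply: hc; apply: leq_trans ln.
have hK : hom0 (K l) (N 1) by apply: hom0_image => //; apply: ln.
have /(pz_extend (@inj_i l.+1))[s [pzs hs]] : pz (u \o i l.+1).
  apply: (pz_descend (ses_ip (ltnW ln)) gQ skc hK).
  by apply: (pz_eq _ hu) => x /=; rewrite dE.
have [|v hv] := hY (u \- s).
  by move=> x; rewrite /= dE -hs subrr.
exists v; apply: pz_eq pzs => x /=.
by rewrite -hv /= opprB addrC subrK.
Qed.

End Contravariant.

Section Covariant.
Variable T : lmodType A.
Hypothesis h0 : forall k j, (0 < j < n)%N -> syz_hom0 j T (X k).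

(** Downward induction from K n, which is X (n+1) because [d n] is surjective; [q] stands for n -
    l. *)
Let syz_hom0_image l j : (l <= n)%N -> (0 < j < l)%N -> syz_hom0 j T (K l).
Proof.
move=> ln; rewrite -(subKn ln); move: (n - l)%N (leq_subr l n) => {ln l}.
move=> q qn; elim: q j qn => [|q IHq] j qn.
  rewrite subn0 => jn; have [|s hs] := @linear_lift A (X n.+1) (K n) _ (i n) idfun (@inj_i n).
    by move=> y; have [x <-] := surj_d y; exists (p n x); rewrite -dE.
  apply: (syz_hom0_iso (f := s)) (h0 _ jn).
    by move=> x y /(congr1 (i n)); rewrite !hs.
  by move=> y; exists (i n y); apply: (@inj_i n); rewrite hs.
move=> /andP[j0 jn]; have e : (n - q = (n - q.+1).+1)%N by rewrite -subSn.
have lt : (n - q.+1 < n)%N by rewrite -e leq_subr.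
apply: (syz_hom0_left (ses_ip lt)).
  by apply: h0; rewrite j0 (ltn_trans jn lt).
by rewrite -e; apply: IHq; [exact: ltnW | rewrite e].
Qed.

(** Once [p (l+1) \o u] is stably zero, [u] can be corrected by a stably zero map so that d (l+1)
    kills it. The obstruction lies in stable Hom (T, Omega K (l+2)); when l + 1 = n there is none,
    as [i n] is an isomorphism. *)
Lemma covariant_pz_exact l (u : {linear T -> X l.+1}) : (l < n)%N ->
  (forall w : {linear T -> X l.+1}, (forall x, d l.+1 (w x) = 0) ->
     exists v : {linear T -> X l}, forall x, w x = d l (v x)) ->
  pz (d l.+1 \o u) -> exists v : {linear T -> X l}, pz (u \- (d l \o v)).
Proof.
move=> ln hT hu.
have /(pz_lift (@surj_p l.+1))[s [pzs hs]] : pz (p l.+1 \o u).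
  have hi : pz (i l.+1 \o (p l.+1 \o u)) by apply: (pz_eq _ hu) => x /=; rewrite dE.
  have [ln1|nl] := ltnP l.+1 n.
    have [|P [N' [a [b [gP sab oN]]]]] := @syz_hom0_image l.+2 1 ln1; first by [].
    exact: (pz_lift_ses (ses_ip ln1) gP sab oN hi).
  have e : l.+1 = n by apply/eqP; rewrite eqn_leq ln nl.
  have surj_i : surjective (i l.+1).
    have : surjective (d l.+1) by rewrite e.
    by move=> sd y; have [x <-] := sd y; exists (p l.+1 x); rewrite dE.
  have [|r hr] := @linear_descend A _ _ _ (i l.+1) idfun surj_i.
    by move=> x h; apply: (@inj_i l.+1); rewrite h linear0.
  apply: (@pz_eq _ _ _ _ (r \o (i l.+1 \o (p l.+1 \o u)))); last exact: pz_compl.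
  by move=> x /=; rewrite hr.
have [|v hv] := hT (u \- s).
  by move=> x; rewrite dE /= linearB /= -hs /= subrr linear0.
exists v; apply: pz_eq pzs => x /=.
by rewrite -hv /= opprB addrC subrK.
Qed.

End Covariant.

End Sequence.

End Chains.

(** * Finitely generated modules and cluster tilting *)

Section FreeModules.
Variable A : pzRingType.
Implicit Types V : lmodType A.

Lemma row_linear m V (e : 'I_m -> V) :
  exists g : {linear 'rV[A]_m -> V}, forall x, g x = \sum_i x 0 i *: e i.
Proof.
have [|g hg] := @linear_of_fun A 'rV[A]_m V (fun x => \sum_i x 0 i *: e i).
  move=> a x y; rewrite scaler_sumr -big_split; apply: eq_bigr => i _ /=.
  by rewrite !mxE scalerDl scalerA.
by exists g => x; rewrite hg.
Qed.

Lemma row_expand m V (f : {linear 'rV[A]_m -> V}) x :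
  f x = \sum_i x 0 i *: f (delta_mx 0 i).
Proof. by rewrite [in LHS](row_sum_delta x) linear_sum; apply: eq_bigr => i _; rewrite linearZ. Qed.

Lemma row_proj_inj m : injective_object (A^o : Mod A) -> proj_inj ('rV[A]_m : lmodType A).
Proof.
move=> injA; split=> [Y Z e f /choice[s hs] | Y Z j f inj_j].
  have [g hg] := row_linear (fun i => s (f (delta_mx 0 i))).
  exists g => x; rewrite hg linear_sum [RHS]row_expand.
  by apply: eq_bigr => i _; rewrite linearZ hs.
have mono_j : @mono (Mod A) Y Z (j : lin Y Z).
  move=> T g h gh; apply: lin_eq => x; apply: inj_j.
  exact: (congr1 (fun q : lin T Z => (q : {linear _ -> _}) x) gh).
have co i : exists g : {linear Z -> A^o}, forall y, g (j y) = f y 0 i.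
  have [|c hc] := @linear_of_fun A Y A^o (fun y => f y 0 i).
    by move=> a x y; rewrite linearP !mxE.
  have [g hg] := injA Y Z j mono_j (c : lin Y A^o).
  exists (g : lin Z A^o) => y; rewrite -hc.
  exact/esym/(congr1 (fun q : lin Y A^o => (q : {linear _ -> _}) y) hg).
pose g i := sval (cid (co i)).
have hg i y : g i (j y) = f y 0 i by rewrite /g; case: cid.
have [|h hh] := @linear_of_fun A Z 'rV[A]_m (fun z => \row_i g i z).
  by move=> a x y; apply/rowP => i; rewrite !mxE linearP.
by exists h => y; rewrite hh; apply/rowP => i; rewrite !mxE hg.
Qed.

Lemma row_fin_generated m : fin_generated ('rV[A]_m : Mod A).
Proof.
exists m, (fun i => delta_mx 0 i) => x; exists (fun i => x 0 i).
exact: row_sum_delta.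
Qed.

Definition row_fg m : fgMod A := exist _ ('rV[A]_m : Mod A) (row_fin_generated m).

Lemma fg_cover (X : fgMod A) :
  exists m (e : hom (row_fg m) X), surjective (app e).
Proof.
case: X => X fX; have [m [v hv]] := fX; have [g hg] := row_linear v.
exists m, (g : lin 'rV[A]_m X) => x; have [c ->] := hv x.
exists (\row_i c i); rewrite [LHS]hg.
by apply: eq_bigr => i _; rewrite mxE.
Qed.

Lemma app_eq (X Y : fgMod A) (f g : hom X Y) : app f =1 app g -> f = g.
Proof. exact: lin_eq. Qed.

Lemma surjective_epi (X Y : fgMod A) (e : hom X Y) : surjective (app e) -> epi e.
Proof.
move=> se Z g h gh; apply: app_eq => y; have [x <-] := se y.
by rewrite -!app_comp gh.
Qed.

Lemma projective_proj_inj (P : fgMod A) :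
  injective_object (A^o : Mod A) -> projective P -> proj_inj (sval P : lmodType A).
Proof.
move=> injA pP; have [m [e se]] := fg_cover P.
have [s hs] := pP _ _ e (surjective_epi se) (idm P).
apply: (proj_inj_retract (s := app s) (r := app e)); last exact: row_proj_inj.
by move=> x; rewrite -app_comp -hs app_id.
Qed.

Lemma element_map (X : fgMod A) (x : sval X) :
  exists u : hom (row_fg 1) X, app u (const_mx 1) = x.
Proof.
have [g hg] := @row_linear 1 (sval X) (fun=> x).
by exists (g : lin 'rV[A]_1 (sval X)); rewrite [LHS]hg big_ord1 mxE scale1r.
Qed.

Lemma row1_eq (X : fgMod A) (u v : hom (row_fg 1) X) :
  app u (const_mx 1) = app v (const_mx 1) -> u = v.
Proof.
move=> h; apply: app_eq => x; have -> : x = x 0 0 *: (const_mx 1 : 'rV[A]_1).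
  by apply/rowP => i; rewrite !mxE mulr1 !ord1.
by rewrite !linearZ h.
Qed.

(** Elements are maps from the free module of rank one, so the universal property of a categorical
    kernel can be read on elements. *)
Lemma kernel_ses (X Y K : fgMod A) (k : hom K X) (f : hom X Y) :
  surjective (app f) -> is_kernel k f -> ses (app k) (app f).
Proof.
move=> sf [fk0 ker].
have fk x : app f (app k x) = 0 by rewrite -app_comp fk0.
split=> // [x y h | x].
  have [u hu] := element_map x; have [v hv] := element_map y.
  have e : k \oc u = k \oc v by apply: row1_eq; rewrite !app_comp hu hv.
  have [|w [_ hw]] := ker _ (k \oc u); first by rewrite compA fk0 comp0m.
  by rewrite -hu -hv -(hw u) // -(hw v).
split=> [h|[y ->] //]; have [u hu] := element_map x.
have [|w [hw _]] := ker _ u; first by apply: row1_eq; rewrite app_comp hu h.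
by exists (app w (const_mx 1)); rewrite -app_comp -hw hu.
Qed.

End FreeModules.

(** * Projectives and vanishing stable Hom groups in an nZ-cluster tilting family *)

Section ClusterTiltingFacts.
Variables (A : pzRingType) (n : nat) (M : additive_family (fgMod A)).
Hypotheses (injA : injective_object (A^o : Mod A)) (n1 : (1 < n)%N)
  (ctM : nZ_cluster_tilting n M).

Let ct : n_cluster_tilting n M := ctM.1.

Lemma in_family_member i : in_family M (M i).
Proof. by exists i, (idm (M i)); exists (idm (M i)); rewrite comp1m. Qed.

(** The vanishing of Ext^1 (M i, M i) comes with a projective resolution, whose term of degree 0 is
    the cover. A free module also covers [M i], but its projectivity against categorical epis
    presupposes [epi_surjective], which is derived from this cover. *)
Lemma projective_cover_member i :
  exists (P : fgMod A) (e : hom P (M i)), projective P /\ surjective (app e).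
Proof.
have [/(_ (in_family_member i)) h _] := right_rigid ct (M i).
have [P [d [e [[pP se _ _] _]]]] := h i 1%N n1.
by exists (P 0%N), e.
Qed.

Lemma projective_cover_exists (X : fgMod A) :
  exists (P : fgMod A) (e : hom P X), projective P /\ surjective (app e).
Proof.
have [i [f sf]] := generating ct X; have [P [e [pP se]]] := projective_cover_member i.
exists P, (f \oc e); split=> // x.
by have [y <-] := sf x; have [z <-] := se y; exists z; rewrite app_comp.
Qed.

Lemma epi_surjective (X Y : fgMod A) (e : hom X Y) : epi e -> surjective (app e).
Proof.
move=> epi_e y; have [P [f [pP sf]]] := projective_cover_exists Y.
have [g hg] := pP _ _ e epi_e f; have [x <-] := sf y.
by exists (app g x); rewrite hg app_comp.
Qed.

Lemma projective_in_family (P : fgMod A) : projective P -> in_family M P.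
Proof.
move=> pP; apply/(left_rigid ct) => i k /andP[k0 _].
have [Z Z0] := addcat_zero (fgMod A).
have z0 (x : sval Z) : x = 0 by rewrite -[x]app_id Z0 app_zero.
have pZ : projective Z.
  by move=> X Y e _ f; exists 0; apply: app_eq => x; rewrite (z0 x) !linear0.
(* P is its own resolution: all terms of positive degree are zero. *)
pose R j : fgMod A := if j is 0 then P else Z.
exists R, (fun j => 0 : hom (R j.+1) (R j)), (idm P); split.
  split=> [[|j] | y | x | j x] //; first by exists y.
    by split=> [h|[y ->]] //; exists 0; rewrite -[x]app_id h.
  by split=> // _; exists 0; rewrite (z0 x).
case: k k0 => // k _ f _; exists 0; apply: app_eq => x.
by rewrite (z0 x) !linear0.
Qed.

Lemma family_cover (i : idx M) :
  exists (j : idx M) (e : hom (M j) (M i)), projective (M j) /\ surjective (app e).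
Proof.
have [P [e [pP se]]] := projective_cover_member i.
have [j [f [g [gf fg]]]] := projective_in_family pP.
exists j, (e \oc g); split; last first.
  move=> x; have [y <-] := se x; exists (app f y).
  by rewrite app_comp -[app g _]app_comp gf app_id.
move=> Y Z h eh t; have [u hu] := pP _ _ h eh (t \oc f).
by exists (u \oc g); rewrite compA -hu -compA fg compm1.
Qed.

(* Projectives in the family detect elements, since [row_fg 1] is covered by one. *)
Lemma family_element (X : fgMod A) (x : sval X) : exists (j : idx M) (u : hom (M j) X) y,
  [/\ projective (M j), app u y = x &
    forall (Y : fgMod A) (f : hom X Y), app f x = 0 -> f \oc u = 0].
Proof.
have [P [e [pP se]]] := projective_cover_exists (row_fg A 1).
have [j [f [g [gf fg]]]] := projective_in_family pP.
have [v hv] := element_map x; have [y hy] := se (const_mx 1).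
exists j, (v \oc e \oc g), (app f y); split.
- move=> Y Z h eh t; have [u hu] := pP _ _ h eh (t \oc f).
  by exists (u \oc g); rewrite compA -hu -compA fg compm1.
- by rewrite !app_comp -[app g _]app_comp gf app_id hy.
- move=> Y h hx; have -> : v \oc e \oc g = v \oc (e \oc g) by rewrite compA.
  rewrite compA; have -> : h \oc v = 0 by apply: row1_eq; rewrite app_comp hv.
  by rewrite comp0m.
Qed.

Lemma syzygy_chain q (X K : fgMod A) : is_nth_syzygy q X K ->
  exists (N Q : nat -> lmodType A)
    (k : forall j, {linear N j.+1 -> Q j}) (c : forall j, {linear Q j -> N j}),
  [/\ N 0 = sval X, N q = sval K
    & forall j, (j < q)%N -> proj_inj (Q j) /\ ses (k j) (c j)].
Proof.
elim: q X => [|q IHq] X /=.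
  move=> ->; pose N (j : nat) : lmodType A := sval X.
  by exists N, N, (fun j => idfun), (fun j => idfun).
move=> [Y [[P [e [k0 [[pP epi_e _] ker]]]] /IHq[N [Q [k [c [N0 Nq h]]]]]]].
have ske := kernel_ses (epi_surjective epi_e) ker.
(* The chain for Y starts at [N 0], which is only propositionally equal to [sval Y]; [k0] is
   transported along this equation before being put in front. *)
move: (app k0) ske; rewrite -N0 => k0' ske.
pose N' j : lmodType A := if j is j'.+1 then N j' else sval X.
pose Q' j : lmodType A := if j is j'.+1 then Q j' else sval P.
exists N', Q', (fun j => match j return {linear N' j.+1 -> Q' j} with
  | 0 => k0' | j'.+1 => k j' end), (fun j => match j return {linear Q' j -> N' j} with
  | 0 => app e | j'.+1 => c j' end).
split=> // -[|j] /= jq; last exact: h.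
by split=> //; apply: projective_proj_inj.
Qed.

Definition syz_chain (Y : lmodType A) (N Q : nat -> lmodType A)
    (k : forall j, {linear N j.+1 -> Q j}) (c : forall j, {linear Q j -> N j}) :=
  [/\ N 0 = Y,
      forall j, (j < n)%N -> proj_inj (Q j) /\ ses (k j) (c j)
    & forall (X : idx M) m, (0 < m < n)%N -> hom0 (sval (M X)) (N m)].

Lemma syz_chain_exists (Y : idx M) : exists N Q k c, @syz_chain (sval (M Y)) N Q k c.
Proof.
have [K [sK fK]] := ctM.2 Y; have [N [Q [k [c [N0 Nn h]]]]] := syzygy_chain sK.
exists N, Q, k, c; split=> // X m /andP[m0 mn].
have n_m : (0 < n - m < n)%N by rewrite subn_gt0 mn ltn_subrL m0 (ltn_trans m0).
have [/(_ fK) /(_ X (n - m)%N n_m) ext _] := right_rigid ct K.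
move: ext; rewrite /Ext_vanishes; move: n_m => /andP[].
case E: (n - m)%N => [//|r] _ rn [P [d [e [[pP se ex0 exd] van]]]].
have rE : (r.+1 + m)%N = n by rewrite -E subnK // ltnW.
(* The chain is restarted at N m. As r + 1 + m = n, its term of index r + 1 is the n-th syzygy K,
   which lies in the family. *)
apply: (resolution_hom0 (m := r) (P := fun i => sval (P i)) (N := fun j => N (j + m)%N)
  (Q := fun j => Q (j + m)%N)
  (d := fun i => app (d i)) (e := app e) (k := fun j => k (j + m)%N)
  (c := fun j => c (j + m)%N)) => //.
- by move=> i; apply: projective_proj_inj.
- by move=> j jr; apply: h; rewrite -rE ltn_add2r ltnS.
rewrite rE Nn => f hf.
have [|g hg] := van (f : lin (sval (P r.+1)) (sval K)).
  by apply: app_eq => x; rewrite app_comp hf.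
exists (app g) => x; rewrite -app_comp -hg //.
Qed.

(** The chain of [syz_chain_exists] supplies the syzygies: vanishing at N m is carried back to N 0 =
    Y by induction on the distance [q] from m. *)
Lemma syz_hom0_member (X Y : idx M) m : (0 < m < n)%N -> syz_hom0 m (sval (M X)) (sval (M Y)).
Proof.
move=> /andP[m0 mn]; have [N [Q [k [c [<- h h0]]]]] := syz_chain_exists Y.
suff H q : (q <= m)%N -> syz_hom0 q (sval (M X)) (N (m - q)%N).
  by have := H m (leqnn m); rewrite subnn.
elim: q => [|q IHq] qm; first by rewrite subn0; apply: h0; rewrite m0.
have e : (m - q = (m - q.+1).+1)%N by rewrite -subSn.
have [|gQ skc] := h (m - q.+1)%N; first by rewrite (leq_ltn_trans _ mn) // leq_subr.
exists (Q (m - q.+1)%N), (N (m - q.+1).+1), (k (m - q.+1)%N), (c (m - q.+1)%N).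
by split=> //; rewrite -e; apply/IHq/ltnW.
Qed.

End ClusterTiltingFacts.

Section StablyZero.
Variable A : pzRingType.
Implicit Types X Y Z : fgMod A.

Definition unapp X Y (f : {linear sval X -> sval Y}) : hom X Y :=
  (f : lin (sval X) (sval Y)).

Definition spz X Y (u : hom X Y) : Prop := pz (app u).

Lemma spz_compl X Y Z (g : hom Y Z) (u : hom X Y) : spz u -> spz (g \oc u).
Proof. by move=> h; apply: (pz_eq _ (pz_compl (app g) h)). Qed.

Lemma spz_compr X Y Z (u : hom Y Z) (f : hom X Y) : spz u -> spz (u \oc f).
Proof. by move=> h; apply: (pz_eq _ (pz_compr (app f) h)). Qed.

(** Applied to a projective cover inside the family, this turns stable vanishing into a
    factorization between members of M, as presentations require. *)
Lemma spz_factor X Y P (e : hom P Y) (u : hom X Y) :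
  surjective (app e) -> spz u -> exists v, u = e \oc v.
Proof.
move=> se /(pz_lift se)[s [_ hs]]; exists (s : lin (sval X) (sval P)).
by apply: app_eq => x; rewrite app_comp hs.
Qed.

Hypothesis injA : injective_object (A^o : Mod A).

Lemma spz_src X Y (u : hom X Y) : projective X -> spz u.
Proof. by move=> pX; apply: pz_proj_inj_src; apply: projective_proj_inj. Qed.

Lemma spz_tgt X Y (u : hom X Y) : projective Y -> spz u.
Proof. by move=> pY; rewrite -[u]comp1m; apply/spz_compr/spz_src. Qed.

Lemma spz0 X Y : spz (0 : hom X Y).
Proof.
have [Z [Z0 pZ]] := projective_zero (fgMod A).
by rewrite -(compm0 X (0 : hom Z Y)); apply/spz_compl/spz_tgt.
Qed.

End StablyZero.

(* Stated with morphisms of C and not of [family_cat M]: converting between the two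
   is expensive when C is concrete. *)
Section FamilySequences.
Variables (C : addcat) (M : additive_family C) (n : nat).

Definition family_n_exact (e : nat -> idx M)
    (d : forall k, hom (M (e k)) (M (e k.+1))) : Prop := forall i : idx M,
  [/\ forall u : hom (M i) (M (e 0)), d 0 \oc u = 0 -> u = 0,
      forall k, (k < n)%N -> forall u : hom (M i) (M (e k.+1)),
        d k.+1 \oc u = 0 <-> exists v, u = d k \oc v,
      forall u : hom (M (e n.+1)) (M i), u \oc d n = 0 -> u = 0
    & forall k, (k < n)%N -> forall u : hom (M (e k.+1)) (M i),
        u \oc d k = 0 <-> exists v, u = v \oc d k.+1].

Definition seq_idx (E : sequence_in (family_cat M)) (k : nat) : idx M := E k.

Definition seq_hom (E : sequence_in (family_cat M)) (k : nat) :
  hom (M (seq_idx E k)) (M (seq_idx E k.+1)) := fhom (sq_d E k).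

Lemma n_exact_family (E : sequence_in (family_cat M)) :
  n_exact n E -> family_n_exact (seq_hom E).
Proof. by move=> exE i; have [h1 h2 h3 h4] := exE i; split. Qed.

Lemma sq_map_family (E E' : sequence_in (family_cat M)) (phi : forall k, hom (E k) (E' k)) :
  is_sq_map n phi -> forall k, (k <= n)%N ->
  seq_hom E' k \oc fhom (phi k) = fhom (phi k.+1) \oc seq_hom E k.
Proof. by move=> h k /h. Qed.

End FamilySequences.

(** * Stable exactness of n-exact sequences in both variables *)

Section NExactSequences.
Variables (A : pzRingType) (n : nat) (M : additive_family (fgMod A)).
Hypotheses (injA : injective_object (A^o : Mod A)) (n1 : (1 < n)%N)
  (ctM : nZ_cluster_tilting n M).
Variables (e : nat -> idx M) (d : forall k, hom (M (e k)) (M (e k.+1))).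

Hypothesis ex : family_n_exact n d.

Lemma n_exact_comp0 k : (k < n)%N -> d k.+1 \oc d k = 0.
Proof.
by move=> kn; have [_ h _ _] := ex (e k); apply/(h k kn); exists (idm _); rewrite compm1.
Qed.

Let X k : lmodType A := sval (M (e k)).
Let D k : {linear X k -> X k.+1} := app (d k).

(** Exactness of Hom (M i, -) becomes exactness on elements because projective members detect
    elements; the same holds for [ex_d]. *)
Let inj_d : injective (D 0).
Proof.
move=> x y hxy; apply/eqP; rewrite -subr_eq0; apply/eqP.
have [j [u [z [_ uz hu]]]] := family_element n1 ctM (x - y).
have [inj _ _ _] := ex j.
have u0 : u = 0.
  by apply: inj; apply: hu; rewrite linearB [app _ x]hxy subrr.
by move: uz; rewrite u0 app_zero => <-.
Qed.

Let ex_d k : (k < n)%N -> forall x, D k.+1 x = 0 <-> exists y, x = D k y.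
Proof.
move=> kn x; split=> [h|[y ->]]; last by rewrite -[LHS]app_comp n_exact_comp0.
have [j [u [z [_ uz hu]]]] := family_element n1 ctM x.
have [_ exj _ _] := ex j.
have /(exj k kn)[v hv] := hu _ (d k.+1) h.
by exists (app v z); rewrite -app_comp -hv uz.
Qed.

Hypothesis surj_d : surjective (app (d n)).

Lemma covariant_stable_exact l (T : idx M) (u : hom (M T) (M (e l.+1))) : (l < n)%N ->
  spz (d l.+1 \oc u) -> exists v, spz (u - d l \oc v).
Proof.
move=> ln hu.
have h0 k j (jn : (0 < j < n)%N) : syz_hom0 j (sval (M T)) (X k).
  exact: (syz_hom0_member injA n1 ctM T (e k) jn).
have hT (w : {linear sval (M T) -> X l.+1}) : (forall x, D l.+1 (w x) = 0) ->
    exists v : {linear sval (M T) -> X l}, forall x, w x = D l (v x).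
  move=> hw; have [_ exT _ _] := ex T.
  have /(exT l ln)[v hv] : d l.+1 \oc (@unapp A (M T) (M (e l.+1)) w) = 0.
    exact: app_eq.
  by exists (app v) => x; rewrite -app_comp -hv.
have [v hv] := covariant_pz_exact surj_d ex_d h0 (u := app u) ln hT hu.
by exists (@unapp A (M T) (M (e l)) v); apply: pz_eq hv.
Qed.

Lemma contravariant_stable_exact l (Y : idx M) (u : hom (M (e l.+2)) (M Y)) :
  (l.+2 <= n)%N -> spz (u \oc d l.+1) -> exists v, spz (u - v \oc d l.+2).
Proof.
move=> ln hu.
have [N [Q [k [c [N0 hc h0]]]]] := syz_chain_exists injA n1 ctM Y.
have hY (w : {linear X l.+2 -> sval (M Y)}) : (forall x, w (D l.+1 x) = 0) ->
    exists v : {linear X l.+3 -> sval (M Y)}, forall x, w x = v (D l.+2 x).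
  move=> hw; have [_ _ _ exY] := ex Y.
  have /(exY l.+1 ln)[v hv] : @unapp A (M (e l.+2)) (M Y) w \oc d l.+1 = 0.
    exact: app_eq.
  by exists (app v) => x; rewrite -app_comp -hv.
have := @contravariant_pz_exact A n X D inj_d ex_d N Q k c hc (fun k j jn => h0 _ j jn) l.
rewrite N0 => /(_ (app u) ln hY hu)[v hv].
by exists (@unapp A (M (e l.+3)) (M Y) v); apply: pz_eq hv.
Qed.

End NExactSequences.

(** * Finitely presented functors *)

Section NaturalTransformations.
Variables (C : addcat) (M : additive_family C).
Implicit Types F G H : presheaf M.

Lemma additive_of_fun (U V : zmodType) (f : U -> V) :
  (forall x y, f (x - y) = f x - f y) -> exists g : {additive U -> V}, g =1 f.
Proof.
move=> hf; pose L := GRing.isZmodMorphism.Build U V f hf.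
by exists (HB.pack_for {additive U -> V} f L).
Qed.

Lemma nat_trans_of_fun F G (f : forall X, F X -> G X) :
  (forall X x y, f X (x - y) = f X x - f X y) ->
  (forall X Y (u : hom (M X) (M Y)) x, f X (psh_map F u x) = psh_map G u (f Y x)) ->
  exists s : nat_trans F G, forall X x, s X x = f X x.
Proof.
move=> fB fN; have H X := cid (additive_of_fun (fB X)).
have HE X x : sval (H X) x = f X x by rewrite (svalP (H X)).
have hN X Y (u : hom (M X) (M Y)) x :
    sval (H X) (psh_map F u x) = psh_map G u (sval (H Y) x).
  by rewrite !HE fN.
by exists (@NatTrans _ _ F G (fun X => sval (H X)) hN).
Qed.

Lemma psh_map0 F (X Y : idx M) (x : F Y) : psh_map F (0 : hom (M X) (M Y)) x = 0.
Proof. by apply: (addrI (psh_map F 0 x)); rewrite -psh_mapD !addr0. Qed.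

Lemma psh_mapB F (X Y : idx M) (u v : hom (M X) (M Y)) (x : F Y) :
  psh_map F (u - v) x = psh_map F u x - psh_map F v x.
Proof. by apply: (addIr (psh_map F v x)); rewrite -psh_mapD !subrK. Qed.

Definition nt_surj F G (s : nat_trans F G) : Prop := forall Z y, exists x, s Z x = y.

Lemma yoneda_natural F (X0 : idx M) (q : nat_trans (yoneda X0) F) (Y Z : idx M)
    (u : hom (M Y) (M X0)) (f : hom (M Z) (M Y)) :
  q Z (u \oc f) = psh_map F f (q Y u).
Proof. by rewrite -nt_natural. Qed.

Lemma yonedaE F (X0 : idx M) (q : nat_trans (yoneda X0) F) (Z : idx M)
    (u : hom (M Z) (M X0)) :
  q Z u = psh_map F u (q X0 (idm (M X0))).
Proof. by rewrite -yoneda_natural comp1m. Qed.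

Lemma yonedaB F (X0 : idx M) (q : nat_trans (yoneda X0) F) (Z : idx M)
    (u v : hom (M Z) (M X0)) : q Z (u - v) = q Z u - q Z v.
Proof. exact: raddfB. Qed.

Lemma yonedaD F (X0 : idx M) (q : nat_trans (yoneda X0) F) (Z : idx M)
    (u v : hom (M Z) (M X0)) : q Z (u + v) = q Z u + q Z v.
Proof. exact: raddfD. Qed.

(** Yoneda: a map out of a quotient of M(-, X0) is an element of [G X0] killed by the relations. *)
Lemma nt_descend F G (X0 : idx M) (q : nat_trans (yoneda X0) F) (x : G X0) :
  nt_surj q ->
  (forall Z (u : hom (M Z) (M X0)), q Z u = 0 -> psh_map G u x = 0) ->
  exists s : nat_trans F G, forall Z u, s Z (q Z u) = psh_map G u x.
Proof.
move=> surj_q h0.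
have c Z := choice (surj_q Z); pose r Z := projT1 (c Z).
have hr Z y : q Z (r Z y) = y := projT2 (c Z) y.
have hG Z (u v : hom (M Z) (M X0)) : q Z u = q Z v -> psh_map G u x = psh_map G v x.
  move=> e; apply/eqP; rewrite -subr_eq0 -psh_mapB; apply/eqP/h0.
  by rewrite yonedaB e subrr.
have [||s hs] := @nat_trans_of_fun F G (fun Z y => psh_map G (r Z y) x).
- by move=> Z y z; rewrite -psh_mapB; apply: hG; rewrite yonedaB !hr.
- move=> Y Z f y; rewrite -psh_mapM; apply: hG.
  by rewrite hr yoneda_natural hr.
by exists s => Z u; rewrite hs; apply: hG; rewrite hr.
Qed.

Lemma nt_lift F G H (k : nat_trans F G) (t : nat_trans H G) :
  (forall Z, injective (k Z)) -> (forall Z x, exists y, t Z x = k Z y) ->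
  exists s : nat_trans H F, forall Z x, k Z (s Z x) = t Z x.
Proof.
move=> inj_k ex.
have c Z := choice (ex Z); pose r Z := projT1 (c Z).
have hr Z x : t Z x = k Z (r Z x) := projT2 (c Z) x.
have [||s hs] := @nat_trans_of_fun H F r.
- by move=> Z x y; apply: (inj_k Z); rewrite raddfB -!hr raddfB.
- by move=> Y Z f x; apply: (inj_k Y); rewrite nt_natural -!hr nt_natural.
by exists s => Z x; rewrite hs -hr.
Qed.

End NaturalTransformations.

Section Cokernel.
Variables (C : addcat) (M : additive_family C) (X1 X0 : idx M) (d : hom (M X1) (M X0)).
Local Open Scope quotient_scope.

Definition cok_pred (Z : idx M) : {pred hom (M Z) (M X0)} :=
  fun u => `[< exists v, u = d \oc v >].
Arguments cok_pred : clear implicits.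

Lemma cok_closed (Z : idx M) : zmod_closed (cok_pred Z).
Proof.
split; first by apply/asboolP; exists 0; rewrite compm0.
by move=> _ _ /asboolP[u ->] /asboolP[v ->]; apply/asboolP; exists (u - v); rewrite compBr.
Qed.

HB.instance Definition _ (Z : idx M) :=
  GRing.isZmodClosed.Build (hom (M Z) (M X0)) (cok_pred Z) (@cok_closed Z).

Definition cok_ob (Z : idx M) : zmodType := Quotient.quot (cok_pred Z : zmodClosed _).

Definition cok_pi (Z : idx M) (u : hom (M Z) (M X0)) : cok_ob Z := \pi u.

Lemma cok_piP (Z : idx M) (u v : hom (M Z) (M X0)) :
  cok_pi u = cok_pi v <-> exists w, u - v = d \oc w.
Proof.
rewrite /cok_pi; split=> [/eqP|h]; first by rewrite -Quotient.idealrBE => /asboolP.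
by apply/eqP; rewrite -Quotient.idealrBE; apply/asboolP.
Qed.

Lemma cok_pi_repr (Z : idx M) (x : cok_ob Z) : cok_pi (repr x) = x.
Proof. exact: reprK. Qed.

Lemma cok_piB (Z : idx M) (u v : hom (M Z) (M X0)) :
  cok_pi (u - v) = cok_pi u - cok_pi v.
Proof. by rewrite /cok_pi piE. Qed.

Lemma cok_piD (Z : idx M) (u v : hom (M Z) (M X0)) :
  cok_pi (u + v) = cok_pi u + cok_pi v.
Proof. by rewrite /cok_pi piE. Qed.

Definition cok_map (Y Z : idx M) (f : hom (M Y) (M Z)) (x : cok_ob Z) : cok_ob Y :=
  cok_pi (repr x \oc f).

Lemma cok_map_pi (Y Z : idx M) (f : hom (M Y) (M Z)) u :
  cok_map f (cok_pi u) = cok_pi (u \oc f).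
Proof.
have /cok_piP[w hw] := cok_pi_repr (cok_pi u).
by apply/cok_piP; exists (w \oc f); rewrite -compBl hw compA.
Qed.

Lemma cok_mapB (Y Z : idx M) (f : hom (M Y) (M Z)) : zmod_morphism (cok_map f).
Proof.
move=> x y; rewrite -(cok_pi_repr x) -(cok_pi_repr y) -cok_piB !cok_map_pi.
by rewrite compBl cok_piB.
Qed.

HB.instance Definition _ (Y Z : idx M) (f : hom (M Y) (M Z)) :=
  GRing.isZmodMorphism.Build _ _ (cok_map f) (cok_mapB f).

Definition cok : presheaf M.
Proof.
exists cok_ob (fun Y Z f => cok_map f : {additive _ -> _}) => /=.
- by move=> Z x; rewrite -(cok_pi_repr x) cok_map_pi compm1.
- by move=> Y Z T g f x; rewrite -(cok_pi_repr x) !cok_map_pi compA.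
- by move=> Y Z f g x; rewrite -(cok_pi_repr x) !cok_map_pi compDr cok_piD.
Defined.

Lemma cok_exists : exists (F : presheaf M) (q : nat_trans (yoneda X0) F), presents d q.
Proof.
have [||q hq] := @nat_trans_of_fun C M (yoneda X0) cok (fun Z u => cok_pi u).
- by move=> Z u v; rewrite cok_piB.
- by move=> Y Z f u; rewrite /= cok_map_pi.
exists cok, q => Z; split=> [y|u]; first by exists (repr y); rewrite hq cok_pi_repr.
rewrite hq; split=> [h|[v ->]].
  have /cok_piP[v hv] : cok_pi u = cok_pi 0.
    by rewrite h -(subrr (0 : hom (M Z) (M X0))) cok_piB subrr.
  by exists v; rewrite -hv subr0.
have : cok_pi (d \oc v) = cok_pi 0 by apply/cok_piP; exists v; rewrite subr0.
by move=> ->; rewrite -(subrr (0 : hom (M Z) (M X0))) cok_piB subrr.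
Qed.

End Cokernel.

(** * Presentations of functors by stable maps *)

Section StablePresentations.
Variables (A : pzRingType) (n : nat) (M : additive_family (fgMod A)).
Hypotheses (injA : injective_object (A^o : Mod A)) (n1 : (1 < n)%N)
  (ctM : nZ_cluster_tilting n M).
Implicit Types F G H : umod_cat M.

Definition unt F G (s : nat_trans (under F) (under G)) : @hom (umod_cat M) F G := s.

Lemma untK F G (s : nat_trans (under F) (under G)) : umod_nt (unt s) = s.
Proof. by []. Qed.

Lemma umod_comp F G H (t : hom G H) (s : hom F G) Z x :
  umod_nt (t \oc s) Z x = umod_nt t Z (umod_nt s Z x).
Proof. by []. Qed.

Lemma umod_id F Z x : umod_nt (idm F) Z x = x.
Proof. by []. Qed.

Lemma umod_zero F G Z x : umod_nt (0 : hom F G) Z x = 0.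
Proof. by []. Qed.

Lemma umod_add F G (s t : hom F G) Z x :
  umod_nt (s + t) Z x = umod_nt s Z x + umod_nt t Z x.
Proof. by []. Qed.

Lemma umod_eq F G (s t : hom F G) :
  (forall Z x, umod_nt s Z x = umod_nt t Z x) -> s = t.
Proof. exact: nat_trans_eq. Qed.

Lemma umod_vanish F (X : idx M) (x : under F X) : projective (M X) -> x = 0.
Proof. by move=> pX; apply: (svalP F). Qed.

(** A stably zero map factors through a projective member, where F is zero; thus F is a functor of
    stable maps. *)
Lemma umod_spz F (X Y : idx M) (u : hom (M X) (M Y)) (x : under F Y) :
  spz u -> psh_map (under F) u x = 0.
Proof.
have [P [e [pP se]]] := family_cover n1 ctM Y.
move=> /(spz_factor se)[v ->].
by rewrite psh_mapM (umod_vanish (psh_map _ e x) pP) raddf0.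
Qed.

Lemma umod_surjective_epi F G (s : hom F G) : nt_surj (umod_nt s) -> epi s.
Proof.
move=> surj_s H g h gh; apply: umod_eq => Z y; have [x <-] := surj_s Z y.
by rewrite -!umod_comp gh.
Qed.

(* F is the cokernel of d on the functors of stable maps. *)
Definition spresents (X1 X0 : idx M) (d : hom (M X1) (M X0)) (F : presheaf M)
    (q : nat_trans (yoneda X0) F) : Prop :=
  nt_surj q /\
  forall Z (u : hom (M Z) (M X0)), q Z u = 0 <-> exists v, spz (u - d \oc v).

Lemma presents_spresents (X1 X0 : idx M) (d : hom (M X1) (M X0)) F
    (q : nat_trans (yoneda X0) (under F)) : presents d q -> spresents d q.
Proof.
move=> dq; split=> [Z|Z u]; first exact: (dq Z).1.
split=> [/(dq Z).2[v ->]|[v hv]]; first by exists v; rewrite subrr; apply: spz0.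
rewrite -(subrK (d \oc v) u) yonedaD.
have -> : q Z (d \oc v) = 0 by apply/(dq Z).2; exists v.
by rewrite addr0 yonedaE umod_spz.
Qed.

(** Adjoining a projective cover [e] of X0 to the relations kills exactly the stably zero maps, so
    the ordinary cokernel of (d, e) : X1 + P -> X0 is the stable cokernel of d. *)
Lemma spresents_exists (X1 X0 : idx M) (d : hom (M X1) (M X0)) :
  exists F (q : nat_trans (yoneda X0) (under F)), spresents d q.
Proof.
have [P [e [pP se]]] := family_cover n1 ctM X0.
have [B [i1 [i2 [p1 [p2 [h1 h2 h3 h4 h5]]]]]] := family_biproduct M X1 P.
have [F [q dq]] := cok_exists (d \oc p1 + e \oc p2).
have fpF : finitely_presented F by exists B, X0, (d \oc p1 + e \oc p2), q.
have qspz (Z : idx M) (u : hom (M Z) (M X0)) : spz u -> q Z u = 0.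
  move=> /(spz_factor se)[v ->]; apply/(dq Z).2; exists (i2 \oc v).
  by rewrite compDl -!compA (compA p1) (compA p2) h2 h3 comp0m comp1m compm0 add0r.
have vF : vanishes_on_projectives (exist _ F fpF : mod_cat M).
  move=> Z pZ x; have [u <-] := (dq Z).1 x.
  by apply/qspz/spz_src.
exists (exist _ (exist _ F fpF : mod_cat M) vF), q; split=> [Z|Z u]; first exact: (dq Z).1.
split=> [/(dq Z).2[v hv]|[v hv]].
  exists (p1 \oc v); rewrite hv compDl compA addrC addKr.
  by rewrite -compA; apply/spz_compr/spz_src.
rewrite -(subrK (d \oc v) u) yonedaD qspz // add0r; apply/(dq Z).2; exists (i1 \oc v).
by rewrite compDl -!compA (compA p1) (compA p2) h1 h4 comp0m comp1m compm0 addr0.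
Qed.

Lemma spresents_map (X1 X0 : idx M) (d : hom (M X1) (M X0)) F G
    (q : nat_trans (yoneda X0) (under F)) (x : under G X0) :
  spresents d q -> psh_map (under G) d x = 0 ->
  exists s : hom F G, forall Z u, umod_nt s Z (q Z u) = psh_map (under G) u x.
Proof.
move=> [surj_q hq] dx; have [|s hs] := nt_descend (G := under G) (x := x) surj_q.
  move=> Z u /hq[v hv]; rewrite -(subrK (d \oc v) u) psh_mapD psh_mapM dx raddf0 addr0.
  exact: umod_spz.
by exists (unt s).
Qed.

Lemma spresents_eq (X1 X0 : idx M) (d : hom (M X1) (M X0)) F G
    (q : nat_trans (yoneda X0) (under F)) (s t : hom F G) :
  spresents d q -> (forall Z u, umod_nt s Z (q Z u) = umod_nt t Z (q Z u)) -> s = t.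
Proof.
by move=> [surj_q _] st; apply: umod_eq => Z y; have [u <-] := surj_q Z y.
Qed.

(* The cokernel of s is again finitely presented and vanishes on projectives, hence
   is zero when s is epi in [umod_cat M]. *)
Lemma umod_epi_surjective F G (s : hom F G) : epi s -> nt_surj (umod_nt s).
Proof.
move=> epi_s; have [X1 [X0 [f [p fp]]]] := svalP (sval G).
have [Y1 [Y0 [g [q gq]]]] := svalP (sval F).
have sG : spresents f (p : nat_trans _ (under G)) by apply: presents_spresents.
have [w hw] : exists w : hom (M Y0) (M X0), p Y0 w = umod_nt s Y0 (q Y0 (idm (M Y0))).
  exact: (fp Y0).1.
have sq (Z : idx M) (u : hom (M Z) (M Y0)) : umod_nt s Z (q Z u) = p Z (w \oc u).
  by rewrite yonedaE nt_natural -hw -yoneda_natural.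
have [B [i1 [i2 [p1 [p2 [h1 h2 h3 h4 h5]]]]]] := family_biproduct M X1 Y0.
have [H [r [surj_r hr]]] := spresents_exists (f \oc p1 + w \oc p2).
have [|t ht] := spresents_map (x := r X0 (idm (M X0)) : under H X0) sG.
  rewrite -yonedaE; apply/hr; exists i1.
  rewrite compDl -!compA h1 h4 compm1 compm0 addr0 subrr; exact: spz0.
have t0 : t = 0.
  apply: epi_s; apply: umod_eq => Z x; have [u <-] := (gq Z).1 x.
  rewrite umod_comp sq ht -yonedaE comp0m umod_zero; apply/hr; exists (i2 \oc u).
  rewrite compDl -!compA (compA p1) (compA p2) h2 h3 comp0m comp1m compm0 add0r.
  by rewrite subrr; apply: spz0.
move=> Z y; have [u <-] := (fp Z).1 y.
have : r Z u = 0 by rewrite yonedaE -ht t0 umod_zero.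
move=> /hr[v hv]; exists (q Z (p2 \oc v)); rewrite sq.
apply/esym/eqP; rewrite -subr_eq0 -yonedaB; apply/eqP/sG.2; exists (p1 \oc v).
suff -> : u - w \oc (p2 \oc v) - f \oc (p1 \oc v) = u - (f \oc p1 + w \oc p2) \oc v by [].
by rewrite compDl -!compA opprD addrA addrAC.
Qed.

(** When d is stably zero, F is the functor of stable maps into X0, and Yoneda reduces lifting along
    an epi to its pointwise surjectivity. *)
Lemma spresents_projective (X1 X0 : idx M) (d : hom (M X1) (M X0)) F
    (q : nat_trans (yoneda X0) (under F)) :
  spresents d q -> spz d -> projective F.
Proof.
move=> dq d0 G H e /umod_epi_surjective surj_e f.
have [y hy] := surj_e X0 (umod_nt f X0 (q X0 (idm (M X0)))).
have [|s hs] := spresents_map (x := y) dq; first exact: umod_spz.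
exists s; apply: (spresents_eq dq) => Z u.
by rewrite umod_comp hs nt_natural hy -nt_natural -yonedaE.
Qed.

Lemma spresents_section (X1 X0 : idx M) (d : hom (M X1) (M X0)) F
    (q : nat_trans (yoneda X0) (under F)) (s : hom (M X0) (M X1)) :
  spresents d q -> spz (idm (M X0) - d \oc s) -> is_zero F.
Proof.
move=> dq ds; apply: (spresents_eq dq) => Z u; rewrite umod_id umod_zero.
by apply/dq.2; exists (s \oc u); rewrite compA -[X in X - _]comp1m -compBl; apply: spz_compr.
Qed.

End StablePresentations.

(** * Short exact sequences between consecutive cokernels *)

Section StableSyzygies.
Variables (A : pzRingType) (n : nat) (M : additive_family (fgMod A)).
Hypotheses (injA : injective_object (A^o : Mod A)) (n1 : (1 < n)%N)
  (ctM : nZ_cluster_tilting n M).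
Implicit Types F G H Q : umod_cat M.

Lemma umod_kernel F G H (k : hom F G) (c : hom G H) :
  (forall Z, injective (umod_nt k Z)) ->
  (forall Z x, umod_nt c Z x = 0 <-> exists y, x = umod_nt k Z y) ->
  is_kernel k c.
Proof.
move=> inj_k ex; split=> [|T t ct].
  by apply: umod_eq => Z x; rewrite umod_comp umod_zero; apply/ex; exists x.
have [|s hs] := nt_lift (t := umod_nt t) inj_k.
  by move=> Z x; apply/ex; rewrite -umod_comp ct umod_zero.
exists (unt s); split=> [|s' e]; first by apply: umod_eq => Z x; rewrite umod_comp untK hs.
by apply: umod_eq => Z x; apply: inj_k; rewrite untK hs -umod_comp -e.
Qed.

(** This is 0 -> D_l -> St X_(l+2) -> D_(l+1) -> 0, with [d] the map X_(l+1) -> X_(l+2). The zero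
    endomorphism of [Y2] presents St Y2. *)
Definition stable_ses (Y1 Y2 : idx M) (d : hom (M Y1) (M Y2)) F Q G
    (q : nat_trans (yoneda Y1) (under F)) (r : nat_trans (yoneda Y2) (under Q))
    (p : nat_trans (yoneda Y2) (under G)) (k : hom F Q) (c : hom Q G) : Prop :=
  [/\ syzygy_seq k c,
      spresents (0 : hom (M Y2) (M Y2)) r,
      forall Z u, umod_nt k Z (q Z u) = r Z (d \oc u)
    & forall Z u, umod_nt c Z (r Z u) = p Z u].

Lemma stable_ses_exists (e : nat -> idx M) (d : forall k, hom (M (e k)) (M (e k.+1)))
    l F G (q : nat_trans (yoneda (e l.+1)) (under F))
    (p : nat_trans (yoneda (e l.+2)) (under G)) :
  family_n_exact n d -> surjective (app (d n)) -> (l < n)%N ->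
  spresents (d l) q -> spresents (d l.+1) p ->
  exists Q r k c, @stable_ses _ _ (d l.+1) F Q G q r p k c.
Proof.
move=> exd surj_d ln sq sp.
have [Q [r sr]] := spresents_exists injA n1 ctM (0 : hom (M (e l.+2)) (M (e l.+2))).
have r0 Z u : r Z u = 0 <-> spz u.
  by rewrite sr.2; split=> [[v]|h]; [rewrite comp0m subr0 | exists 0; rewrite comp0m subr0].
have dd : d l.+1 \oc d l = 0 by apply: (n_exact_comp0 exd).
have [|k hk] := spresents_map n1 ctM (x := r (e l.+1) (d l.+1)) sq.
  by rewrite -yoneda_natural dd; apply/r0/spz0.
have {}hk Z u : umod_nt k Z (q Z u) = r Z (d l.+1 \oc u).
  by rewrite hk -yoneda_natural.
have [|c hc] := spresents_map n1 ctM (x := p (e l.+2) (idm _)) sr.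
  by rewrite psh_map0.
have {}hc Z u : umod_nt c Z (r Z u) = p Z u by rewrite hc -yonedaE.
exists Q, r, k, c; split=> //; split.
- by apply: (spresents_projective injA n1 ctM sr); apply: spz0.
- apply: umod_surjective_epi => Z y; have [u <-] := sp.1 Z y.
  by exists (r Z u).
apply: umod_kernel => Z.
  (* Injectivity of [k] is exactness of the stabilised sequence at X_(l+1). *)
  move=> x y; have [u <-] := sq.1 Z x; have [v <-] := sq.1 Z y.
  rewrite !hk => /eqP; rewrite -subr_eq0 -yonedaB -compBr => /eqP /r0 h.
  have [w hw] := covariant_stable_exact injA n1 ctM exd surj_d ln h.
  by apply/eqP; rewrite -subr_eq0 -yonedaB; apply/eqP/sq.2; exists w.
move=> x; have [u <-] := sr.1 Z x; rewrite hc; split=> [/sp.2[v hv]|[y]].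
  exists (q Z v); rewrite hk; apply/eqP; rewrite -subr_eq0 -yonedaB; apply/eqP.
  exact/r0.
have [v <-] := sq.1 Z y; rewrite hk => /eqP; rewrite -subr_eq0 -yonedaB => /eqP /r0 h.
by apply/sp.2; exists v.
Qed.

Lemma stable_ses_covers (Y1 Y2 : idx M) (d : hom (M Y1) (M Y2)) F Q G
    (q : nat_trans (yoneda Y1) (under F)) (r : nat_trans (yoneda Y2) (under Q))
    (p : nat_trans (yoneda Y2) (under G)) (k : hom F Q) (c : hom Q G)
    (Y1' Y2' : idx M) (d' : hom (M Y1') (M Y2')) F' Q' G'
    (q' : nat_trans (yoneda Y1') (under F')) (r' : nat_trans (yoneda Y2') (under Q'))
    (p' : nat_trans (yoneda Y2') (under G')) (k' : hom F' Q') (c' : hom Q' G')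
    (f : hom (M Y1) (M Y1')) (g : hom (M Y2) (M Y2')) (w : hom F F') (x : hom G G') :
  nt_surj q -> stable_ses d q r p k c -> stable_ses d' q' r' p' k' c' ->
  d' \oc f = g \oc d ->
  (forall Z u, umod_nt w Z (q Z u) = q' Z (f \oc u)) ->
  (forall Z u, umod_nt x Z (p Z u) = p' Z (g \oc u)) ->
  covers k c k' c' x w.
Proof.
move=> surj_q [_ sr hk hc] [_ sr' hk' hc'] dfg hw hx.
have [|t ht] := spresents_map n1 ctM (x := r' Y2 g) sr; first by rewrite psh_map0.
have {}ht Z u : umod_nt t Z (r Z u) = r' Z (g \oc u) by rewrite ht -yoneda_natural.
exists t; split.
  by apply: (spresents_eq sr) => Z u; rewrite !umod_comp hc hx ht hc'.
apply: umod_eq => Z y; have [u <-] := surj_q Z y.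
by rewrite !umod_comp hk ht hw hk' !compA dfg.
Qed.

End StableSyzygies.

(** * Homotopies, additive functors and syzygy functors *)

Section Homotopy.
Variables (C : precat) (n : nat) (E E' : sequence_in C).
Hypotheses (exE : n_exact n E) (exE' : n_exact n E').

(** In each degree the remainder phi - d h kills the incoming differential, hence factors through
    the outgoing one, which gives the next h. In degree n + 1 the incoming differential is
    right-cancellable, so the remainder is zero. *)
Lemma null_homotopic_last (phi : forall i, hom (E i) (E' i)) (h0 : hom (E 1) (E' 0)) :
  is_sq_map n phi -> phi 0 = h0 \oc sq_d E 0 ->
  exists h, phi n.+1 = sq_d E' n \oc h.
Proof.
move=> sq e0.
have H i : (i <= n)%N -> exists h : hom (E i.+1) (E' i),
    (phi i.+1 - sq_d E' i \oc h) \oc sq_d E i = 0.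
  elim: i => [|i IHi] hi.
    by exists h0; rewrite compBl -sq // e0 compA subrr.
  have [h hh] := IHi (ltnW hi).
  have [_ _ _ ex] := exE (E' i.+1); have /(ex i hi)[v hv] := hh.
  exists v; rewrite compBl -sq // -compA -hv compBr !compA.
  have [_ ex' _ _] := exE' (E' i).
  have -> : sq_d E' i.+1 \oc sq_d E' i = 0.
    by apply/(ex' i hi); exists (idm _); rewrite compm1.
  by rewrite comp0m subr0 subrr.
have [h hh] := H n (leqnn n); exists h.
have [_ _ inj _] := exE (E' n.+1).
by apply/eqP; rewrite -subr_eq0; apply/eqP/inj.
Qed.

End Homotopy.

Section FamilyHomotopy.
Variables (C : addcat) (M : additive_family C) (n : nat).
Variables (E E' : sequence_in (family_cat M)).
Hypotheses (exE : n_exact n E) (exE' : n_exact n E').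

(** The three lifts are chosen independently, but chi - (phi + psi) is zero in degree 0, so its last
    component factors through the last differential and dies in the cokernel. *)
Lemma lift_additive (phi psi chi : forall i, hom (E i) (E' i)) :
  is_sq_map n phi -> is_sq_map n psi -> is_sq_map n chi ->
  chi 0 = phi 0 + psi 0 ->
  exists h, fhom (chi n.+1)
    = fhom (phi n.+1) + fhom (psi n.+1) + seq_hom E' n \oc fhom h.
Proof.
move=> sphi spsi schi e0; pose omega i := chi i - (phi i + psi i).
have [||h hh] := @null_homotopic_last _ _ _ _ exE exE' omega 0.
- by move=> i hi; rewrite /omega compBr compBl compDr compDl sphi // spsi // schi.
- by rewrite /omega e0 subrr comp0m.
exists h; apply/eqP; rewrite addrC -subr_eq; apply/eqP; exact: hh.
Qed.

Lemma split_contractible (h0 : hom (E 1) (E 0)) : h0 \oc sq_d E 0 = idm (E 0) ->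
  exists h, idm (M (seq_idx E n.+1)) = seq_hom E n \oc h.
Proof.
move=> e0; have [||h hh] := @null_homotopic_last _ _ _ _ exE exE (fun i => idm (E i)) h0.
- by move=> i _; rewrite comp1m compm1.
- by rewrite e0.
by exists (fhom h).
Qed.

End FamilyHomotopy.

Section AdditiveFunctors.
Variables (C D : addcat) (F : functor C D).

(** A [functor] need not preserve sums; additivity of Phi and Psi has to be derived from their
    presentations. *)
Definition additive_functor : Prop :=
  forall (X Y : C) (f g : hom X Y), fmap F (f + g) = fmap F f + fmap F g.

Hypothesis addF : additive_functor.

Lemma additive_functor0 (X Y : C) : fmap F (0 : hom X Y) = 0.
Proof. by apply: (addrI (fmap F 0)); rewrite -addF !addr0. Qed.

Lemma additive_functorB (X Y : C) (f g : hom X Y) :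
  fmap F (f - g) = fmap F f - fmap F g.
Proof. by apply: (addIr (fmap F g)); rewrite -addF !subrK. Qed.

Lemma additive_functor_biproduct (X Y B : C) :
  is_biproduct X Y B -> is_biproduct (F X) (F Y) (F B).
Proof.
move=> [i1 [i2 [p1 [p2 [h1 h2 h3 h4 h5]]]]].
exists (fmap F i1), (fmap F i2), (fmap F p1), (fmap F p2).
by rewrite -!fmapM -addF h1 h2 h3 h4 h5 !fmap1 !additive_functor0.
Qed.

Lemma additive_functor_closure (G : C -> Prop) :
  (forall X, G X -> projective (F X)) ->
  respects_ideals (factor_ideal (additive_closure G)) (factor_ideal (projectives D)) F.
Proof.
move=> pG X Y f g /asboolP[Z [WZ [a [b e]]]].
apply/asboolP; exists (F Z); split; last first.
  by exists (fmap F a), (fmap F b); rewrite -additive_functorB e fmapM.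
elim: WZ {a b e} => [{}Z /pG //|{}Z Z0|X' Y' B _ pX _ pY bB].
- have FZ0 : is_zero (F Z) by rewrite /is_zero -fmap1 Z0 additive_functor0.
  exact: projective_is_zero FZ0.
- exact: projective_biproduct (additive_functor_biproduct bB).
Qed.

End AdditiveFunctors.

Section SyzygyFunctor.
Variables (C : addcat) (Om : functor (stable C) (stable C)) (omP : is_syzygy_functor Om).

(** [is_syzygy_functor] provides one lift of each map; by [covers_stable] every other cover has the
    same stable class, so [Om] may be computed from any cover. *)
Lemma syzygy_functor_seq : exists (P : C -> C) (e : forall X, hom (P X) X)
    (k : forall X, hom (Om X : C) (P X)),
  (forall X, syzygy_seq (k X) (e X)) /\
  forall (X Y : C) (x : hom X Y) w, covers (k X) (e X) (k Y) (e Y) x w ->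
    fmap Om (stab x) = stab w.
Proof.
have [P [e [k [h1 h2]]]] := omP.
have s X : syzygy_seq (k X) (e X) by have [[pP epi_e _] ker] := h1 X.
exists P, e, k; split=> // X Y x w cw.
have [p [v [hp hv ->]]] := h2 X Y x.
by apply: (covers_stable (s X) (s Y) (erefl (stab x)) _ cw); exists p.
Qed.

End SyzygyFunctor.

Section Unit.
Variables (C D : precat) (F : functor C D) (G : functor D C).

Lemma adjunction_unit : left_adjoint F G ->
  exists eta : forall X, hom X (G (F X)),
    (forall X X' (u : hom X X'), eta X' \oc u = fmap G (fmap F u) \oc eta X) /\
    (forall X Y (t : hom X (G Y)), exists! h : hom (F X) Y, t = fmap G h \oc eta X).
Proof.
move=> [a [bij_a nat_a]]; exists (fun X => a X (F X) (idm (F X))); split.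
  move=> X X' u; have := nat_a X X' _ _ u (idm (F X')) (idm (F X')).
  rewrite comp1m comp1m fmap1 comp1m => <-.
  have := nat_a X X _ _ (idm X) (idm (F X)) (fmap F u).
  by rewrite fmap1 !compm1.
have aE X Y (h : hom (F X) Y) : a X Y h = fmap G h \oc a X (F X) (idm (F X)).
  have := nat_a X X _ _ (idm X) (idm (F X)) h.
  by rewrite fmap1 !compm1.
move=> X Y t; have [b ab ba] := bij_a X Y; exists (b t); split.
  by rewrite -aE ba.
by move=> h ->; rewrite -aE ab.
Qed.

End Unit.

(** * Natural isomorphisms with iterated syzygies *)

Section IteratedSyzygies.
Variables (C : addcat) (Om : functor (stable C) (stable C)) (I : Type) (Psi : I -> C).

(** [R f g x w] is meant to hold when [x] and [w] are induced by one map between the sequences of f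
    and g. *)
Definition syzygy_relation (D : I -> C) :=
  forall f g : I, hom (Psi f) (Psi g) -> hom (D f) (D g) -> Prop.

Definition nth_syzygy_iso (m : nat) (D : I -> C) (R : syzygy_relation D) : Prop :=
  exists th : forall f, @hom (stable C) (D f) (iter_functor m Om (Psi f)),
    (forall f, iso (th f)) /\
    forall f g x w, R f g x w ->
      th g \oc stab w = fmap (iter_functor m Om) (stab x) \oc th f.

Lemma nth_syzygy_iso0 (D : I -> C) (R : syzygy_relation D)
    (s : forall f, hom (D f) (Psi f)) (t : forall f, hom (Psi f) (D f)) :
  (forall f, t f \oc s f = idm (D f)) -> (forall f, s f \oc t f = idm (Psi f)) ->
  (forall f g x w, R f g x w -> s g \oc w = x \oc s f) ->
  nth_syzygy_iso 0 R.
Proof.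
move=> ts st nat_s; exists (fun f => stab (s f)); split=> [f|f g x w /nat_s e].
  by apply: (stab_iso (g := t f)); rewrite ?ts ?st.
by rewrite [fmap _ _]/= !stab_comp e.
Qed.

(** [lam] compares the given syzygy D f of D' f with Om (D' f); the new isomorphism is [lam]
    followed by Om applied to the old one. *)
Lemma nth_syzygy_isoS m (D D' : I -> C) (R : syzygy_relation D) (R' : syzygy_relation D')
    (Q : I -> C) (k : forall f, hom (D f) (Q f)) (c : forall f, hom (Q f) (D' f)) :
  is_syzygy_functor Om -> (forall f, syzygy_seq (k f) (c f)) ->
  (forall f g x w, R f g x w ->
     exists w', R' f g x w' /\ covers (k f) (c f) (k g) (c g) w' w) ->
  nth_syzygy_iso m R' -> nth_syzygy_iso m.+1 R.
Proof.
move=> omP skc RR' [th' [iso_th' nat_th']].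
have [P [e [kk [sck omE]]]] := syzygy_functor_seq omP.
have HL f := cid (covers_exists (skc f) (sck (D' f)) (idm _)).
pose lam f := sval (HL f).
have clam f : covers (k f) (c f) (kk (D' f)) (e (D' f)) (idm _) (lam f) := svalP (HL f).
exists (fun f => fmap Om (th' f) \oc stab (lam f)); split=> [f|f g x w /RR'[w' [R'w cw]]].
  apply: iso_comp; first exact: fmap_iso.
  exact: covers_iso (skc f) (sck (D' f)) (clam f).
have [v cv] := covers_exists (sck (D' f)) (sck (D' g)) w'.
have E : stab (lam g) \oc stab w = fmap Om (stab w') \oc stab (lam f).
  rewrite (omE _ _ _ _ cv) !stab_comp.
  apply: (covers_stable (skc f) (sck (D' g)) _ (covers_comp (clam g) cw)
    (covers_comp cv (clam f))).
  by rewrite comp1m compm1.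
by rewrite -compA E !compA -fmapM (nat_th' _ _ _ _ R'w) fmapM.
Qed.

End IteratedSyzygies.

Lemma induced_nat_iso (S C : addcat) (W : ideal S) (Phi Psi : functor S C)
    (Om : functor (stable C) (stable C)) (m : nat)
    (rPhi : respects_ideals W (factor_ideal (projectives C)) Phi)
    (rPsi : respects_ideals W (factor_ideal (projectives C)) Psi)
    (R : syzygy_relation (fun f => Psi f) (fun f => Phi f)) :
  nth_syzygy_iso Om m R ->
  (forall (f g : S) (a : hom f g), R f g (fmap Psi a) (fmap Phi a)) ->
  nat_iso (induced rPhi) (comp_functor (iter_functor m Om) (induced rPsi)).
Proof.
move=> [th [iso_th nat_th]] Ra; exists th; split=> // f g a.
have e1 : fmap (induced rPhi) (qpi W (repr a)) = stab (fmap Phi (repr a)).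
  exact: imap_pi.
have e2 : fmap (induced rPsi) (qpi W (repr a)) = stab (fmap Psi (repr a)).
  exact: imap_pi.
have := nat_th _ _ _ _ (Ra f g (repr a)).
by rewrite -e1 -e2 qpi_repr.
Qed.

Section Reflection.
Variables (A : pzRingType) (n : nat) (M : additive_family (fgMod A)).
Hypotheses (injA : injective_object (A^o : Mod A)) (n1 : (1 < n)%N)
  (ctM : nZ_cluster_tilting n M).

(** The stable cokernel H of d has the universal property of the reflection: maps I -> H and H -> I
    compose to the identity of I, and [eta] after [p] has the same kernel as [r]. Only the unit of
    the adjunction is used, not a formula for the adjoint. *)
Lemma reflection_spresents (U : presheaf M) (I : umod_cat M)
    (eta : nat_trans U (under I))
    (X1 X0 : idx M) (d : hom (M X1) (M X0)) (p : nat_trans (yoneda X0) U) :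
  presents d p ->
  (forall (Y : umod_cat M) (t : nat_trans U (under Y)),
     exists h : hom I Y, forall Z x, umod_nt h Z (eta Z x) = t Z x) ->
  (forall (Y : umod_cat M) (g h : hom I Y),
     (forall Z x, umod_nt g Z (eta Z x) = umod_nt h Z (eta Z x)) -> g = h) ->
  spresents d (nt_comp eta p).
Proof.
move=> dp univ uniq; have [H [r sr]] := spresents_exists injA n1 ctM d.
have [||r' hr'] := nt_descend (G := under H) (q := p) (x := r X0 (idm (M X0))).
- by move=> Z; apply: (dp Z).1.
- move=> Z u /(dp Z).2[v ->]; rewrite -yonedaE; apply/sr.2; exists v.
  by rewrite subrr; apply: spz0.
have {}hr' Z u : r' Z (p Z u) = r Z u by rewrite hr' -yonedaE.
have [r2 hr2] := univ H r'.
have [|s hs] := spresents_map n1 ctM (G := I) (x := eta X0 (p X0 (idm (M X0)))) sr.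
  rewrite -nt_natural -yonedaE; have -> : p X1 d = 0; last by rewrite raddf0.
  by apply/(dp X1).2; exists (idm _); rewrite compm1.
have {}hs Z u : umod_nt s Z (r Z u) = eta Z (p Z u).
  by rewrite hs -nt_natural -yonedaE.
have sr2 : s \oc r2 = idm I.
  apply: uniq => Z x; have [u <-] := (dp Z).1 x.
  by rewrite umod_comp umod_id hr2 hr' hs.
have E Z u : nt_comp eta p Z u = umod_nt s Z (r Z u) by rewrite hs.
split=> [Z y|Z u].
  have [u hu] := sr.1 Z (umod_nt r2 Z y).
  by exists u; rewrite E hu -umod_comp sr2 umod_id.
rewrite -sr.2 E; split=> [h|->]; last by rewrite raddf0.
by rewrite -hr' -hr2 -hs h raddf0.
Qed.

End Reflection.

Section PsiProjective.
Variables (A : pzRingType) (n : nat) (M : additive_family (fgMod A)).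
Hypotheses (injA : injective_object (A^o : Mod A)) (n1 : (1 < n)%N)
  (ctM : nZ_cluster_tilting n M).
Variables (e : nat -> idx M) (d : forall k, hom (M (e k)) (M (e k.+1))).
Hypotheses (exd : family_n_exact n d) (surj_d : surjective (app (d n))).
Variables (F : umod_cat M) (p : nat_trans (yoneda (e n.+1)) (under F)).
Hypothesis sp : spresents (d n) p.

(* The identity of the sequence is null-homotopic modulo projectives in degrees
   1, ..., n; the homotopy makes F a retract of the last stable representable. *)
Lemma cokernel_projective : projective (M (e 1)) -> projective F.
Proof.
move=> pE1.
have H i : (i <= n)%N -> exists h, spz ((idm (M (e i.+1)) - d i \oc h) \oc d i).
  elim: i => [|i IHi] hi; first by exists 0; apply: spz_tgt.
  have [h hh] := IHi (ltnW hi).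
  (* In the lowest degree X_1 is projective, so every map out of it is stably zero; contravariant
     exactness takes over from X_2. *)
  have [v hv] : exists v, spz (idm (M (e i.+1)) - d i \oc h - v \oc d i.+1).
    case: i IHi hi h hh => [|i] _ hi h hh; first by exists 0; apply: spz_src.
    exact: (contravariant_stable_exact injA n1 ctM exd).
  exists v; have := spz_compl (d i.+1) hv.
  rewrite !compBr !compA (n_exact_comp0 exd hi) comp0m subr0 compm1.
  by rewrite compBl comp1m.
have [h hh] := H n (leqnn n).
have [G [r sr]] := spresents_exists injA n1 ctM (0 : hom (M (e n.+1)) (M (e n.+1))).
have r0 Z u : spz u -> r Z u = 0.
  by move=> hu; apply/sr.2; exists 0; rewrite comp0m subr0.
have [|s hs] := spresents_map n1 ctM (x := r _ (idm (M (e n.+1)) - d n \oc h)) sp.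
  by rewrite -yoneda_natural r0.
have [|t ht] := spresents_map n1 ctM (x := p _ (idm (M (e n.+1)))) sr.
  by rewrite psh_map0.
apply: (@projective_retract _ F G s t).
  apply: (spresents_eq sp) => Z u; rewrite umod_comp hs -yoneda_natural ht -yonedaE.
  rewrite umod_id compBl comp1m yonedaB; have -> : p Z (d n \oc h \oc u) = 0; last by rewrite subr0.
  by apply/sp.2; exists (h \oc u); rewrite compA subrr; apply: spz0.
by apply: (spresents_projective injA n1 ctM sr); apply: spz0.
Qed.

End PsiProjective.

Section CokernelSyzygies.
Variables (A : pzRingType) (n : nat) (M : additive_family (fgMod A)).
Hypotheses (injA : injective_object (A^o : Mod A)) (n1 : (1 < n)%N)
  (ctM : nZ_cluster_tilting n M).
Variables (Om : functor (stable (umod_cat M)) (stable (umod_cat M)))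
  (omP : is_syzygy_functor Om).
Variables (I : Type) (e : I -> nat -> idx M)
  (d : forall f k, hom (M (e f k)) (M (e f k.+1))).
Hypotheses (exd : forall f, family_n_exact n (d f))
  (surj_d : forall f, surjective (app (d f n))).
Variables (Psi : I -> umod_cat M)
  (p : forall f, nat_trans (yoneda (e f n.+1)) (under (Psi f))).
Hypothesis sp : forall f, spresents (d f n) (p f).

Definition chain_map f g (phi : forall k, hom (M (e f k)) (M (e g k))) : Prop :=
  forall k, (k <= n)%N -> d g k \oc phi k = phi k.+1 \oc d f k.

Definition induces f g l (phi : forall k, hom (M (e f k)) (M (e g k)))
    (F G : umod_cat M) (q : nat_trans (yoneda (e f l)) (under F))
    (r : nat_trans (yoneda (e g l)) (under G)) (w : hom F G) : Prop :=
  forall Z u, umod_nt w Z (q Z u) = r Z (phi l \oc u).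

Lemma spresents_compare (X1 X0 : idx M) (u : hom (M X1) (M X0)) (F G : umod_cat M)
    (q : nat_trans (yoneda X0) (under F)) (r : nat_trans (yoneda X0) (under G)) :
  spresents u q -> spresents u r ->
  exists s : hom F G, forall Z v, umod_nt s Z (q Z v) = r Z v.
Proof.
move=> sq sr; have [|s hs] := spresents_map n1 ctM (x := r X0 (idm (M X0))) sq.
  rewrite -yonedaE; apply/sr.2; exists (idm _); rewrite compm1 subrr; exact: spz0.
by exists s => Z v; rewrite hs -yonedaE.
Qed.

Lemma induces_exists f g l phi (F G : umod_cat M)
    (q : nat_trans (yoneda (e f l.+1)) (under F))
    (r : nat_trans (yoneda (e g l.+1)) (under G)) :
  (l <= n)%N -> chain_map phi -> spresents (d f l) q -> spresents (d g l) r ->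
  exists w, induces phi q r w.
Proof.
move=> ln cphi sq sr.
have [|s hs] := spresents_map n1 ctM (x := r (e f l.+1) (phi l.+1)) sq.
  rewrite -yoneda_natural -cphi //; apply/sr.2; exists (phi l).
  by rewrite subrr; apply: spz0.
by exists s => Z u; rewrite hs -yoneda_natural.
Qed.

Definition chain_related l (D : I -> umod_cat M)
    (q : forall f, nat_trans (yoneda (e f l)) (under (D f))) : syzygy_relation Psi D :=
  fun f g x w => exists phi, [/\ chain_map phi, induces phi (p f) (p g) x
    & induces phi (q f) (q g) w].

(** With l + m = n, the index l climbs to n as m drops: D_l is a syzygy of D_(l+1), and for m = 0
    both [D] and [Psi] are cokernels of the last map. *)
Lemma cokernel_nth_syzygy m l (D : I -> umod_cat M)
    (q : forall f, nat_trans (yoneda (e f l.+1)) (under (D f))) :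
  (l + m)%N = n -> (forall f, spresents (d f l) (q f)) ->
  nth_syzygy_iso Om m (chain_related q).
Proof.
elim: m l D q => [|m IHm] l D q.
  rewrite addn0 => ln; subst l => sq.
  have H f := cid (spresents_compare (sq f) (sp f)).
  have H' f := cid (spresents_compare (sp f) (sq f)).
  have hs f Z u : umod_nt (sval (H f)) Z (q f Z u) = p f Z u := svalP (H f) Z u.
  have ht f Z u : umod_nt (sval (H' f)) Z (p f Z u) = q f Z u := svalP (H' f) Z u.
  apply: (nth_syzygy_iso0 Om (s := fun f => sval (H f)) (t := fun f => sval (H' f))).
  - by move=> f; apply: (spresents_eq (sq f)) => Z u; rewrite umod_comp hs ht.
  - by move=> f; apply: (spresents_eq (sp f)) => Z u; rewrite umod_comp ht hs.
  - move=> f g x w [phi [cphi hx hw]]; apply: (spresents_eq (sq f)) => Z u.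
    by rewrite !umod_comp hw !hs hx.
rewrite addnS -addSn => lmn sq.
have ln : (l < n)%N by rewrite -lmn leq_addr.
have HD f := cid (spresents_exists injA n1 ctM (d f l.+1)).
pose D' f := sval (HD f); have HQ f := cid (svalP (HD f)).
pose q' f : nat_trans (yoneda (e f l.+2)) (under (D' f)) := sval (HQ f).
have sq' f : spresents (d f l.+1) (q' f) := svalP (HQ f).
have H1 f := cid (stable_ses_exists injA n1 ctM (exd f) (@surj_d f) ln (sq f) (sq' f)).
have H2 f := cid (svalP (H1 f)); have H3 f := cid (svalP (H2 f)).
have H4 f := cid (svalP (H3 f)); have ses f := svalP (H4 f).
apply: (nth_syzygy_isoS (k := fun f => sval (H3 f)) (c := fun f => sval (H4 f)) omP
  _ _ (IHm l.+1 D' q' lmn sq')) => [f|f g x w [phi [cphi hx hw]]].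
  by have [] := ses f.
have [w' hw'] := induces_exists ln cphi (sq' f) (sq' g).
exists w'; split; first by exists phi.
exact: (stable_ses_covers n1 ctM (sq f).1 (ses f) (ses g) (cphi _ ln)).
Qed.

End CokernelSyzygies.

(** * The functors Phi and Psi on monomorphisms *)

Section Surjective.
Variables (A : pzRingType) (n : nat) (M : additive_family (fgMod A)).
Hypotheses (injA : injective_object (A^o : Mod A)) (n1 : (1 < n)%N)
  (ctM : nZ_cluster_tilting n M).
(* The cokernel vanishes on projectives, and projectives detect elements. *)
Lemma presents_surjective (X1 X0 : idx M) (u : hom (M X1) (M X0)) (F : umod_cat M)
    (p : nat_trans (yoneda X0) (under F)) : presents u p -> surjective (app u).
Proof.
move=> up x; have [j [v [y [pj <- _]]]] := family_element n1 ctM x.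
have /(up j).2[w ->] : p j v = 0 by apply: umod_vanish.
by exists (app w y); rewrite app_comp.
Qed.

End Surjective.

Lemma squareD (C : addcat) (F G : arrow C) (u v : square F G) :
  (u + v).1 = u.1 + v.1 /\ (u + v).2 = u.2 + v.2.
Proof. by []. Qed.

Lemma arrowsD (C : addcat) (F G : arrows C) (u v : hom F G) :
  (u + v : square F G).1 = (u : square F G).1 + (v : square F G).1 /\
  (u + v : square F G).2 = (u : square F G).2 + (v : square F G).2.
Proof. exact: squareD. Qed.

Lemma fullD (C : addcat) (P : additive_class (arrows C)) (f g : full P) (a b : hom f g) :
  let sq (c : hom f g) := (c : square (sval f) (sval g)) in
  (sq (a + b)).1 = (sq a).1 + (sq b).1 /\ (sq (a + b)).2 = (sq a).2 + (sq b).2.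
Proof. exact: arrowsD. Qed.

Lemma hom_srctgtD (A : pzRingType) (M : additive_family (fgMod A)) (f g : mono_cat M)
    (a b : hom f g) :
  hom_src (a + b) = hom_src a + hom_src b /\ hom_tgt (a + b) = hom_tgt a + hom_tgt b.
Proof. exact: fullD. Qed.

Section MonoFunctors.
Variables (A : pzRingType) (n : nat) (M : additive_family (fgMod A)).
Hypotheses (injA : injective_object (A^o : Mod A)) (n1 : (1 < n)%N)
  (ctM : nZ_cluster_tilting n M).
Notation CM := (family_cat M).

Lemma Phi_spresents (Ups : functor (mono_cat M) (mod_cat M))
    (il : functor (mod_cat M) (umod_cat M)) :
  is_Upsilon Ups -> left_adjoint il (inclusion (vanishing_class M)) ->
  exists q : forall f : mono_cat M,
      nat_trans (yoneda (stgt f)) (under (comp_functor il Ups f)),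
    (forall f, spresents (fhom (smap f)) (q f)) /\
    forall (f g : mono_cat M) (a : hom f g) Z u,
      umod_nt (fmap (comp_functor il Ups) a) Z (q f Z u)
      = q g Z (fhom (hom_tgt a) \oc u).
Proof.
move=> [p [pP nat_p]] /adjunction_unit[eta [nat_eta univ]].
exists (fun f => nt_comp (mod_nt (eta (Ups f))) (p f)); split=> [f|f g a Z u].
  apply: (reflection_spresents injA n1 ctM (pP f)) => [Y t|Y g h gh].
    have [h [eh _]] := univ (Ups f) Y t.
    exists h => Z x.
    by rewrite eh.
  have [k [_ uk]] := univ (Ups f) Y (fmap (inclusion (vanishing_class M)) g \oc eta (Ups f)).
  have <- : k = g by apply: uk.
  by apply: uk; apply: nat_trans_eq.
have := congr1 (fun s => mod_nt s Z (p f Z u)) (nat_eta _ _ (fmap Ups a)).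
move=> e; rewrite -[RHS]/(mod_nt (eta (Ups g)) Z (p g Z _)) -nat_p.
exact: esym e.
Qed.

(** Trades an equation between arrows, which is awkward to transport along, for a two-sided inverse
    of [smap f]. *)
Lemma W_generator_cases (f : mono_cat M) : W_generator f ->
  [\/ exists h : @hom CM (stgt f) (ssrc f), h \oc smap f = @idm CM (ssrc f) /\
        smap f \oc h = @idm CM (stgt f),
      is_zero (M (ssrc f)) | projective (M (stgt f))].
Proof.
case=> [[i e]|z|pP]; [apply: Or31 | exact: Or32 | exact: Or33].
rewrite /smap /ssrc /stgt e; exists (@idm CM i).
by split; apply: (@comp1m CM).
Qed.

Lemma Phi_projective (f : mono_cat M) (F : umod_cat M)
    (q : nat_trans (yoneda (stgt f)) (under F)) :
  spresents (fhom (smap f)) q -> W_generator f -> projective F.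
Proof.
move=> sq /W_generator_cases[[h [_ h2]]|z|pP].
- apply: projective_is_zero.
  apply: (spresents_section (s := fhom h) sq).
  by rewrite -fhom_comp h2 fhom_id subrr; apply: spz0.
- apply: (spresents_projective injA n1 ctM sq).
  by rewrite -[fhom _]compm1 z compm0; apply: spz0.
- by apply: (spresents_projective injA n1 ctM sq); apply: spz_tgt.
Qed.

Lemma Phi_additive (Phi : functor (mono_cat M) (umod_cat M))
    (q : forall f : mono_cat M, nat_trans (yoneda (stgt f)) (under (Phi f))) :
  (forall f, spresents (fhom (smap f)) (q f)) ->
  (forall (f g : mono_cat M) (a : hom f g) Z u,
      umod_nt (fmap Phi a) Z (q f Z u) = q g Z (fhom (hom_tgt a) \oc u)) ->
  additive_functor Phi.
Proof.
move=> sq nat_q f g a b; apply: (spresents_eq (sq f)) => Z u.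
by rewrite umod_add nat_q (nat_q _ _ a) (nat_q _ _ b) -yonedaD -compDl (hom_srctgtD a b).2.
Qed.

Definition completed (T : mono_cat M -> sequence_in CM)
    (c : forall f, hom (stgt f : CM) (T f 0)) (f : mono_cat M) : sequence_in CM :=
  splice (smap f) (c f).

Section Psi.
Variables (T : mono_cat M -> sequence_in CM) (c : forall f, hom (stgt f : CM) (T f 0)).
Notation E := (completed c).
Variables (Psi : functor (mono_cat M) (umod_cat M)).
Variable p : forall f, nat_trans (yoneda (seq_idx (E f) n.+1)) (under (Psi f)).
Hypotheses (exE : forall f, n_exact n (E f))
  (pP : forall f, presents (seq_hom (E f) n) (p f)).
Hypothesis nat_p : forall (f g : mono_cat M) (a : hom f g),
  exists phi : forall i, hom (E f i) (E g i),
    [/\ is_sq_map n phi, phi 0 = hom_src a, phi 1 = hom_tgt a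
      & forall Z u, umod_nt (fmap Psi a) Z (p f Z u) = p g Z (fhom (phi n.+1) \oc u)].

Let sp f : spresents (seq_hom (E f) n) (p f) := presents_spresents injA n1 ctM (pP f).

Lemma Psi_additive : additive_functor Psi.
Proof.
move=> f g a b.
have [phi [sphi e1 _ nphi]] := nat_p a; have [psi [spsi e2 _ npsi]] := nat_p b.
have [chi [schi e3 _ nchi]] := nat_p (a + b).
have [|h hh] := lift_additive (exE f) (exE g) sphi spsi schi.
  by rewrite e3 (hom_srctgtD a b).1 -e1 -e2.
apply: (spresents_eq (sp f)) => Z u; rewrite umod_add nphi npsi nchi hh !compDl !yonedaD.
have -> : p g Z (seq_hom (E g) n \oc fhom h \oc u) = 0; last by rewrite addr0.
by apply/(pP g Z).2; exists (fhom h \oc u); rewrite compA.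
Qed.

(** For M -> M and 0 -> M the completed sequence starts with a split monomorphism; its last map then
    splits too, and Psi f is zero. *)
Lemma Psi_projective (f : mono_cat M) : W_generator f -> projective (Psi f).
Proof.
have split (h : hom (E f 1) (E f 0)) : h \oc sq_d (E f) 0 = idm (E f 0) -> projective (Psi f).
  move=> /(split_contractible (exE f))[h' e].
  apply: projective_is_zero; apply: (spresents_section (s := h') (sp f)).
  by rewrite -e subrr; apply: spz0.
move=> /W_generator_cases[[h [h1 _]]|z|pE1]; first exact: (split h).
  by apply: (split 0); rewrite comp0m; apply/esym; exact: z.
exact: (cokernel_projective injA n1 ctM (n_exact_family (exE f)) (sp f) pE1).
Qed.

Variables (Phi : functor (mono_cat M) (umod_cat M))
  (q : forall f : mono_cat M, nat_trans (yoneda (stgt f)) (under (Phi f))).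
Hypotheses (sq : forall f, spresents (fhom (smap f)) (q f))
  (nat_q : forall (f g : mono_cat M) (a : hom f g) Z u,
      umod_nt (fmap Phi a) Z (q f Z u) = q g Z (fhom (hom_tgt a) \oc u)).
Variables (Om : functor (stable (umod_cat M)) (stable (umod_cat M)))
  (omP : is_syzygy_functor Om).

Let related : syzygy_relation (fun f => Psi f) (fun f => Phi f) :=
  @chain_related A n M (mono_cat M) (fun f => seq_idx (E f)) (fun f => seq_hom (E f))
    (fun f => Psi f) p 1 (fun f => Phi f) q.

Lemma Phi_nth_syzygy : nth_syzygy_iso Om n related.
Proof.
have surj_d f : surjective (app (seq_hom (E f) n)) := presents_surjective n1 ctM (@pP f).
have exd f : family_n_exact n (seq_hom (E f)) := n_exact_family (exE f).
exact: (@cokernel_nth_syzygy A n M injA n1 ctM Om omP (mono_cat M) _ _ exd surj_d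
  _ _ sp n 0 _ q (add0n n) sq).
Qed.

Lemma Phi_Psi_related (f g : mono_cat M) (a : hom f g) :
  related (fmap Psi a) (fmap Phi a).
Proof.
have [phi [sphi _ e1 nphi]] := nat_p a.
exists (fun k => fhom (phi k)); split; first exact: sq_map_family.
  exact: nphi.
by move=> Z u; rewrite nat_q -e1.
Qed.

End Psi.

End MonoFunctors.

Theorem theorem5p3 (R : comNzRingType) (L : algType R) (n : nat)
    (M : additive_family (fgMod L^c)) :
  artin_algebra L -> self_injective L -> (1 < n)%N -> nZ_cluster_tilting n M ->
  forall (Ups : functor (mono_cat M) (mod_cat M))
         (il : functor (mod_cat M) (umod_cat M))
         (Psi : functor (mono_cat M) (umod_cat M))
         (Om : functor (stable (umod_cat M)) (stable (umod_cat M))),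
  is_Upsilon Ups ->
  left_adjoint il (inclusion (vanishing_class M)) ->
  is_Psi n Psi ->
  is_syzygy_functor Om ->
  let Phi := comp_functor il Ups in
  let W := factor_ideal (W_class M) in
  let P := factor_ideal (projectives (umod_cat M)) in
  exists (rPhi : respects_ideals W P Phi) (rPsi : respects_ideals W P Psi),
    nat_iso (induced rPhi) (comp_functor (iter_functor n Om) (induced rPsi)).
Proof.
move=> _ injA n1 ctM Ups il Psi Om upsP ilP [T [c [p [pP nat_p]]]] omP Phi W P.
have := Phi_spresents injA n1 ctM upsP ilP; rewrite -/Phi => -[q [sq nat_q]].
(* From here on [Phi] is known only through its presentation [q]. *)
clearbody Phi.
have rPhi : respects_ideals W P Phi.
  apply: additive_functor_closure; first exact: (Phi_additive sq nat_q).
  by move=> f; apply: (Phi_projective injA n1 ctM (sq f)).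
have exE f : n_exact n (completed c f) := (pP f).1.
have prE f : presents (seq_hom (completed c f) n) (p f) := (pP f).2.
have rPsi : respects_ideals W P Psi.
  apply: additive_functor_closure; first exact: (Psi_additive injA n1 ctM exE prE nat_p).
  by move=> f; apply: (Psi_projective injA n1 ctM exE prE).
exists rPhi, rPsi.
apply: (induced_nat_iso _ _ (Phi_nth_syzygy injA n1 ctM exE prE sq omP)) => f g a.
exact: (Phi_Psi_related nat_p nat_q).
Qed.
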